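(* For every positive integer $n$, at $q=e^{\mathrm i\pi/6}$ the AST partition function at $u_{n+1}=p$, $Z_n(u_1,\ldots,u_n;p)_{\mathrm{AST}}$, is equal to $$3^{-\binom{n+1}{2}} \prod_{i=1}^{n} (p ^2 u_i^2 + 1 + \bar p^2 \bar u_i^2)\; s_{(n-1,n-1,n-2,n-2,\ldots,1,1)}(u_1^2,\bar u_1^2,\ldots,u_n^2, \bar u_n^2).$$
   Context: Here $p,u_1,\dots,u_{n+1}$ are indeterminates; write $\bar x=x^{-1}$ and $\sigma(x)=x-\bar x$. $s_\lambda(x_1,\dots,x_m)=\det_{1\le i,j\le m}(x_i^{\lambda_j+m-j})/\prod_{1\le i<j\le m}(x_i-x_j)$ is the Schur function, with $\lambda$ padded with zero parts to have $m$ parts (here $m=2n$). Graph. Let $\mathcal T_n$ be the graph with vertices $(0,j)$, $1\le j\le 2n+1$, and $(i,j)$, $1\le i\le n+1$, $i\le j\le 2n+2-i$ (matrix coordinates: $i$ increases downwards, $j$ increases to the right). Vertical edges join $(i-1,j)$ and $(i,j)$ whenever both are vertices; horizontal edges join $(i,j)$ and $(i,j+1)$ whenever both are vertices and $i\ge1$. Bulk vertices: $(i,j)$ with $1\le i\le n$, $i<j<2n+2-i$ (degree 4). Left boundary vertices: $(i,i)$, $1\le i\le n$ (one edge going up, one going right). Right boundary vertices: $(i,2n+2-i)$, $1\le i\le n$ (one edge going up, one going left). The remaining vertices have degree 1. A configuration is an orientation of $\mathcal T_n$ such that each bulk vertex has two incoming and two outgoing edges and each top edge is directed upwards (from $(1,j)$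 to $(0,j)$). The label of the bulk vertex $(i,j)$ is $u_iu_{\min(j,2n+2-j)}$, and the label of the boundary vertices $(i,i)$ and $(i,2n+2-i)$ is $u_i$. The weight of a configuration is the product of all vertex weights; degree 1 vertices have weight 1, and the other vertices, with label $u$, have the following weights. Bulk: weight $1$ if both vertical edges are outgoing or both are incoming; $\sigma(q^2u)/\sigma(q^4)$ if both vertical edges point up and both horizontal edges point right, or both vertical edges point down and both horizontal edges point left; $\sigma(q^2\bar u)/\sigma(q^4)$ if both vertical edges point down and both horizontal edges point right, or both vertical edges point up and both horizontal edges point left. Left boundary (AST specialization): vertical edge outgoing and horizontal edge incoming: $\sigma(p\bar u)/\sigma(q^2)$; vertical edge incoming and horizontal edge outgoing: $\sigma(pq^2u)/\sigma(q^2)$; both incoming: $0$; both outgoing: $\sigma(q^2u^2)/\sigma(q^2)$. Right boundary (AST specialization): vertical edge outgoing and horizontal edge incoming: $\sigma(\bar pu)/\sigma(q^2)$; vertical edge incoming and horizontal edge outgoing: $\sigma(\bar pq^2\bar u)/\sigma(q^2)$; both incoming: $0$; both outgoing: $\sigma(q^2\bar u^2)/\sigma(q^2)$. $Z_n(u_1,\dots,u_n;u_{n+1})_{\mathrm{AST}}$ is the sum of the weights of all configurations. *)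

(* Defs.v *)
From mathcomp Require Import all_boot all_order all_algebra.
From mathcomp Require Import complex.
From mathcomp Require Import reals trigo.
From mathcomp Require Import mpoly.

Set Implicit Arguments.
Unset Strict Implicit.
Unset Printing Implicit Defensive.

Import Order.TTheory GRing.Theory Num.Theory.

Local Open Scope ring_scope.

Section Graph.

Variable n : nat.

(* Matrix coordinates (i, j): i increases downwards, j to the right. *)
Definition is_vertex (x : nat * nat) : bool :=
  let: (i, j) := x in
  ((i == 0) && (1 <= j <= 2 * n + 1))%N
  || ((1 <= i <= n + 1) && (i <= j <= 2 * n + 2 - i))%N.

Definition adjacent (x y : nat * nat) : bool :=
  [&& is_vertex x, is_vertex y &
      ((x.2 == y.2) && ((x.1 == y.1.+1) || (y.1 == x.1.+1)))
      || [&& x.1 == y.1, 0 < x.1 & (x.2 == y.2.+1) || (y.2 == x.2.+1)]%N].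

Definition is_bulk (x : nat * nat) : bool :=
  let: (i, j) := x in ((1 <= i <= n) && (i < j < 2 * n + 2 - i))%N.

Definition is_left (x : nat * nat) : bool :=
  let: (i, j) := x in ((1 <= i <= n) && (j == i))%N.

Definition is_right (x : nat * nat) : bool :=
  let: (i, j) := x in ((1 <= i <= n) && (j == 2 * n + 2 - i))%N.

(* Not every point of this rectangle is a vertex of T_n, but every vertex of
   T_n is the coord of exactly one point of it. *)
Definition grid : finType := ('I_n.+2 * 'I_n.*2.+2)%type.

Definition coord (x : grid) : nat * nat := (nat_of_ord x.1, nat_of_ord x.2).

(* An orientation is given by its set of directed edges: (x, y) \in O means
   that the edge between x and y is directed from x to y. *)
Definition is_orientation (O : {set grid * grid}) : bool :=
  [forall x, forall y,
     if adjacent (coord x) (coord y) then ((x, y) \in O) (+) ((y, x) \in O)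
     else (x, y) \notin O].

Definition is_configuration (O : {set grid * grid}) : bool :=
  [&& is_orientation O,
      [forall x, is_bulk (coord x) ==>
         (#|[set y | (x, y) \in O]| == 2) && (#|[set y | (y, x) \in O]| == 2)]
    & [forall x, forall y,
         [&& adjacent (coord x) (coord y), (coord x).1 == 1
           & (coord y).1 == 0]%N
         ==> ((x, y) \in O)]].

Definition directed (O : {set grid * grid}) (x y : nat * nat) : bool :=
  ((inord x.1, inord x.2), (inord y.1, inord y.2)) \in O.

End Graph.

Section Weights.

Variable F : fieldType.
Variables q p : F.

Definition sigma (x : F) : F := x - x^-1.

(* In the weight functions, a Boolean tells whether the corresponding edge
   (up, down, left, right) is outgoing at the vertex. *)

(* The last case does not occur in a configuration. *)
Definition bulk_weight (x : F) (up down left right : bool) : F :=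
  match up, down, left, right with
  | true, true, false, false | false, false, true, true => 1
  | true, false, false, true | false, true, true, false =>
      sigma (q ^+ 2 * x) / sigma (q ^+ 4)
  | false, true, false, true | true, false, true, false =>
      sigma (q ^+ 2 * x^-1) / sigma (q ^+ 4)
  | _, _, _, _ => 0
  end.

Definition left_weight (x : F) (up right : bool) : F :=
  match up, right with
  | true, false => sigma (p * x^-1) / sigma (q ^+ 2)
  | false, true => sigma (p * q ^+ 2 * x) / sigma (q ^+ 2)
  | false, false => 0
  | true, true => sigma (q ^+ 2 * x ^+ 2) / sigma (q ^+ 2)
  end.

Definition right_weight (x : F) (up left : bool) : F :=
  match up, left with
  | true, false => sigma (p^-1 * x) / sigma (q ^+ 2)
  | false, true => sigma (p^-1 * q ^+ 2 * x^-1) / sigma (q ^+ 2)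
  | false, false => 0
  | true, true => sigma (q ^+ 2 * x^-1 ^+ 2) / sigma (q ^+ 2)
  end.

Variable n : nat.
(* u i is u_{i+1} for i = 0, ..., n-1, and v is u_{n+1}. *)
Variables (u : 'I_n -> F) (v : F).

(* The parameter u_k with the 1-based index k = 1, ..., n+1. *)
Definition param (k : nat) : F := if insub k.-1 is Some i then u i else v.

Definition vertex_weight (O : {set grid n * grid n}) (x : nat * nat) : F :=
  let: (i, j) := x in
  let up := directed O x (i.-1, j) in
  let down := directed O x (i.+1, j) in
  let left := directed O x (i, j.-1) in
  let right := directed O x (i, j.+1) in
  if is_bulk n x then
    bulk_weight (param i * param (minn j (2 * n + 2 - j))) up down left right
  else if is_left n x then left_weight (param i) up right
  else if is_right n x then right_weight (param i) up left
  else 1.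

(* Z_n(u_1, ..., u_n; u_{n+1})_AST *)
Definition Z_AST : F :=
  \sum_(O : {set grid n * grid n} | is_configuration O)
     \prod_(x : grid n | is_vertex n (coord x)) vertex_weight O (coord x).

End Weights.

(* s_lambda(x_1, ..., x_m), m = size x; parts of lambda beyond its length are
   read as 0. With 0-based j, the exponent lambda_j + m - j is
   lambda`_j + (m - (j + 1)). *)
Definition schur (F : fieldType) (lambda : seq nat) (x : seq F) : F :=
  let m := size x in
  \det (\matrix_(i < m, j < m) x`_i ^+ (nth 0%N lambda j + (m - j.+1)))
  / \prod_(i < m) \prod_(j < m | (i < j)%N) (x`_i - x`_j).

(* (n-1, n-1, n-2, n-2, ..., 1, 1) *)
Definition double_staircase (n : nat) : seq nat :=
  [seq (n.-1 - j./2)%N | j <- iota 0 n.-1.*2].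

(* (u_1^2, u_1^-2, ..., u_n^2, u_n^-2) *)
Definition squares_and_inverses (F : fieldType) (n : nat) (u : 'I_n -> F) :
    seq F :=
  flatten [seq [:: u i ^+ 2; (u i)^-1 ^+ 2] | i <- enum 'I_n].

(* Rational functions over C = R[i] in the n+1 indeterminates
   u_1, ..., u_n, p, represented by 'X_0, ..., 'X_n in this order. *)
Definition ratfun (R : realType) (n : nat) : fieldType :=
  {fraction {mpoly (R[i])[n.+1]}}.

Definition indet_u (R : realType) (n : nat) (i : 'I_n) : ratfun R n :=
  tofrac ('X_(widen_ord (leqnSn n) i) : {mpoly (R[i])[n.+1]}).

Definition indet_p (R : realType) (n : nat) : ratfun R n :=
  tofrac ('X_(@ord_max n) : {mpoly (R[i])[n.+1]}).

(* e^(i pi / 6) *)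
Definition expi_pi6 (R : realType) : R[i] := (cos (pi / 6) +i* sin (pi / 6))%C.

Definition q_pi6 (R : realType) (n : nat) : ratfun R n :=
  tofrac ((expi_pi6 R)%:MP : {mpoly (R[i])[n.+1]}).

(* Main.v *)
From mathcomp Require Import all_boot all_order all_algebra.
From mathcomp Require Import reals.
From mathcomp Require Import all_fingroup complex trigo mpoly.
From mathcomp Require Import ring lra zify.
Require Import Defs.

(* The triangle is summed row by row. Writing V(u_1, ..., u_n) for the vector of
   partition functions with arbitrary top edges, the Yang-Baxter equation and the
   two reflection equations give an exchange relation between V(.., x, y, ..) and
   V(.., y, x, ..), so that the partition function is symmetric in u_1, ..., u_n.
   As a function of x = u_1 it is a Laurent polynomial with exponents between
   - (2n + 3) and 2n + 3, hence determined by its values at 4n + 8 points: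
   - x^4 = q^4 or q^-4: the first row is frozen, and the partition function
     reduces to the one of u_2, ..., u_n;
   - x = q^2 / u_j or q^-2 / u_j up to sign: moving u_j next to x, the two outer
     rows are frozen up to contributions which cancel, and the partition function
     reduces to the one without u_1 and u_j;
   - x = q^2 / p or q^-2 / p up to sign: moving x to the innermost row, the
     partition function vanishes.
   The right-hand side satisfies the same recurrences, because at q^12 = 1 they
   specialize two arguments a, b of the Schur function to a^3 = b^3, a <> b, and
   all exponents of its numerator alternant are 0 or 1 modulo 3. *)

Set Implicit Arguments.
Unset Strict Implicit.
Unset Printing Implicit Defensive.

Import Order.TTheory GRing.Theory Num.Theory.
Local Open Scope ring_scope.

(** * Row-by-row summation and exchange relations *)

(** The exchange relation is proved for arbitrary top edges because the rows below an outer row see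
    every pattern of vertical edges. Only when all top edges point up does the R-matrix act on both
    sides as the same scalar, which then cancels. Each row sum takes the rows below as a function
    [K] of the edges in between, and [half_row] is 0 on lists of the wrong length, so that no length
    hypotheses have to be carried along.

    The induction does not stay with indeterminates, since x has to take special values while other
    parameters are removed. It runs over lists of elements of a field subject to [generic], a
    condition on 12th powers which sublists inherit; indeterminates enter only at the end.

    The choice u_{n+1} = p makes p the parameter of the middle column, and this supplies four nodes
    of its own. The count is tight: a Laurent polynomial with the given exponents has 4n + 7
    coefficients, against 4n + 8 nodes. *)

Section Transfer.

Variables (F : fieldType) (q p : F).

(* The Boolean of a vertical edge tells whether it points up, the Boolean of a
   horizontal edge whether it points right. *)
Definition bulk_wt (z : F) (t b h k : bool) : F :=
  bulk_weight q z t (~~ b) (~~ h) k.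

Definition left_wt (x : F) (t h : bool) : F := left_weight q p x t h.

Definition right_wt (x : F) (t h : bool) : F := right_weight q p x t (~~ h).

(* The contribution of a row with parameter x, read from its horizontal edge h
   onwards: cs lists the column parameters, ts the vertical edges above it, and
   K is a function of the vertical edges below it. *)
Fixpoint half_row x h (cs : seq F) (K : seq bool -> F) (ts : seq bool) : F :=
  match cs, ts with
  | [::], [:: t] => right_wt x t h * K [::]
  | c :: cs', t :: ts' =>
      \sum_(k : bool) \sum_(b : bool)
        bulk_wt (x * c) t b h k * half_row x k cs' (fun bs => K (b :: bs)) ts'
  | _, _ => 0
  end.

Definition full_row x cs (K : seq bool -> F) (ts : seq bool) : F :=
  if ts is t :: ts' then \sum_(h : bool) left_wt x t h * half_row x h cs K ts' else 0.

(** Since u_{min(j, 2n+2-j)} labels column j, the outer row meets the later parameters, then [p] =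
    u_{n+1} in the middle, then the later ones backwards. The value 1 belongs to the vertex of
    degree 1 under the middle column. *)
Fixpoint triangle_sum (us : seq F) : seq bool -> F :=
  if us is x :: us' then full_row x (us' ++ p :: rev us') (triangle_sum us')
  else fun=> 1.

Lemma eq_half_row x h cs K K' ts :
  K =1 K' -> half_row x h cs K ts = half_row x h cs K' ts.
Proof.
elim: cs h K K' ts => [|c cs IH] h K K' [|t ts] eqK //=.
  by case: ts => //; rewrite eqK.
by do 2![apply: eq_bigr => ? _]; congr (_ * _); apply: IH => bs.
Qed.

Lemma eq_full_row x cs K K' ts :
  K =1 K' -> full_row x cs K ts = full_row x cs K' ts.
Proof.
case: ts => //= t ts eqK; apply: eq_bigr => h _; congr (_ * _).
exact: eq_half_row.
Qed.

Lemma half_row_lin (I : finType) x h cs (a : I -> F) (K : I -> seq bool -> F) ts :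
  half_row x h cs (fun bs => \sum_i a i * K i bs) ts
  = \sum_i a i * half_row x h cs (K i) ts.
Proof.
(* Closes the cases of mismatched lengths, in which every [half_row] is 0. *)
have zero : 0 = \sum_i a i * 0 by rewrite -mulr_suml mulr0.
elim: cs h K ts => [|c cs IH] h K [|t ts] //=.
  case: ts => [|? ?] //; rewrite mulr_sumr.
  by apply: eq_bigr => i _; rewrite mulrCA.
under eq_bigr => k _ do under eq_bigr => b _ do rewrite IH mulr_sumr.
under eq_bigr => k _ do rewrite exchange_big /=.
rewrite exchange_big /=; apply: eq_bigr => i _; rewrite mulr_sumr.
apply: eq_bigr => k _; rewrite mulr_sumr; apply: eq_bigr => b _.
by rewrite mulrCA.
Qed.

(* The weights of a vertex of label q^2 y / x, rotated by 45 degrees and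
   multiplied by sigma (q^4). *)
Definition rmatrix (x y : F) (a b c d : bool) : F :=
  if [&& a == b, c == d & a == c] then sigma (q ^+ 4 * y / x)
  else if (a == c) && (b == d) then sigma (q ^+ 4)
  else if [&& a == d, b == c & a != b] then sigma (x / y)
  else 0.

Fixpoint rmatrix_op x y k (K : seq bool -> F) (ts : seq bool) : F :=
  match k, ts with
  | 0%N, a :: b :: s => \sum_(c : bool) \sum_(d : bool)
      rmatrix x y a b c d * K (c :: d :: s)
  | k'.+1, a :: s => rmatrix_op x y k' (fun s' => K (a :: s')) s
  | _, _ => 0
  end.

Lemma eq_rmatrix_op x y k K K' ts :
  K =1 K' -> rmatrix_op x y k K ts = rmatrix_op x y k K' ts.
Proof.
elim: k K K' ts => [|k IH] K K' [|a ts] eqK //=; last by apply: IH => bs.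
case: ts => // b ts.
by do 2![apply: eq_bigr => ? _]; rewrite eqK.
Qed.

Lemma rmatrix_op_lin (I : finType) x y k (a : I -> F) (K : I -> seq bool -> F) ts :
  rmatrix_op x y k (fun bs => \sum_i a i * K i bs) ts
  = \sum_i a i * rmatrix_op x y k (K i) ts.
Proof.
have zero : 0 = \sum_i a i * 0 by rewrite -mulr_suml mulr0.
elim: k K ts => [|k IH] K [|t ts] //=.
case: ts => [|t' ts] //.
under eq_bigr => c _ do under eq_bigr => d _ do rewrite mulr_sumr.
under eq_bigr => c _ do rewrite exchange_big /=.
rewrite exchange_big /=; apply: eq_bigr => i _; rewrite mulr_sumr.
apply: eq_bigr => c _; rewrite mulr_sumr; apply: eq_bigr => d _.
by rewrite mulrCA.
Qed.

Hypothesis q_neq0 : q != 0.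
Hypothesis sq2 : sigma (q ^+ 2) != 0.
Hypothesis sq4 : sigma (q ^+ 4) != 0.

Hypothesis p_neq0 : p != 0.

(** [sigma (q ^+ 2)] cleared of its negative power, in the shape in which [field] leaves this side
    condition. *)
Lemma q4_sub1_neq0 : (q * q) ^+ 2 - 1 != 0.
Proof.
apply: contraNneq sq2 => e; rewrite /sigma -[X in _ == X](mul0r (q ^- 2)) -e.
by apply/eqP; field.
Qed.

Lemma q8_sub1_neq0 : (q * q) ^+ 4 - 1 != 0.
Proof.
apply: contraNneq sq4 => e; rewrite /sigma -[X in _ == X](mul0r (q ^- 4)) -e.
by apply/eqP; field.
Qed.

(** The crossing of two columns moves from above a row to below it, and the columns change places.
    This is a finite identity, checked for each of the 64 boundary patterns. *)
Lemma yang_baxter_columns (x y z : F) a b c d h l :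
  x != 0 -> y != 0 -> z != 0 ->
  \sum_(e : bool) \sum_(f : bool) \sum_(k : bool)
    rmatrix y z a b e f * bulk_wt (x * y) e c h k * bulk_wt (x * z) f d k l
  = \sum_(e : bool) \sum_(f : bool) \sum_(k : bool)
    bulk_wt (x * z) a e h k * bulk_wt (x * y) b f k l * rmatrix y z e f c d.
Proof.
move=> x0 y0 z0; rewrite !big_bool /rmatrix /bulk_wt /bulk_weight.
case: a; case: b; case: c; case: d; case: h; case: l; simpl; rewrite /sigma.
all: by field; rewrite q_neq0 x0 y0 z0 q8_sub1_neq0.
Qed.

Lemma yang_baxter_rows (x y z : F) a b c d k l :
  x != 0 -> y != 0 -> z != 0 ->
  \sum_(e : bool) \sum_(h : bool) \sum_(g : bool)
    rmatrix x y c d h g * bulk_wt (x * z) a e h k * bulk_wt (y * z) e b g l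
  = \sum_(e : bool) \sum_(h : bool) \sum_(g : bool)
    bulk_wt (y * z) a e c h * bulk_wt (x * z) e b d g * rmatrix x y h g k l.
Proof.
move=> x0 y0 z0; rewrite !big_bool /rmatrix /bulk_wt /bulk_weight.
case: a; case: b; case: c; case: d; case: k; case: l; simpl; rewrite /sigma.
all: by field; rewrite q_neq0 x0 y0 z0 q8_sub1_neq0.
Qed.

(** The left boundary vertices of two consecutive rows, x above y, with the bulk vertex joining
    them: the column of parameter y starts in row x and ends at the left boundary vertex of row
    y. *)
Definition left_pair x y a b h g : F := \sum_(k : bool) \sum_(e : bool)
  left_wt x a k * bulk_wt (x * y) b e k h * left_wt y e g.

Definition right_pair x y c d h g : F := \sum_(k : bool) \sum_(e : bool)
  bulk_wt (x * y) c e h k * right_wt x d k * right_wt y e g.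

(** The reflection equation turns a crossing of the two vertical edges above the left boundary into
    a crossing of the two rows that leave it; [right_reflection] turns it back. *)
Lemma left_reflection (x y : F) a b h g : x != 0 -> y != 0 ->
  \sum_(c : bool) \sum_(d : bool) rmatrix x y a b c d * left_pair x y c d h g
  = \sum_(k : bool) \sum_(l : bool) left_pair y x a b k l * rmatrix x y k l h g.
Proof.
move=> x0 y0; rewrite /left_pair !big_bool /rmatrix /bulk_wt /bulk_weight /left_wt.
case: a; case: b; case: h; case: g; simpl; rewrite /sigma.
all: by field; rewrite ?q_neq0 ?p_neq0 x0 y0 ?q8_sub1_neq0 ?q4_sub1_neq0.
Qed.

Lemma right_reflection (x y : F) c d h g : x != 0 -> y != 0 ->
  \sum_(k : bool) \sum_(l : bool) rmatrix x y h g k l * right_pair x y c d k l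
  = \sum_(a : bool) \sum_(b : bool) rmatrix x y c d a b * right_pair y x a b h g.
Proof.
move=> x0 y0; rewrite /right_pair !big_bool /rmatrix /bulk_wt /bulk_weight /right_wt.
case: c; case: d; case: h; case: g; simpl; rewrite /sigma.
all: by field; rewrite ?q_neq0 ?p_neq0 x0 y0 ?q8_sub1_neq0 ?q4_sub1_neq0.
Qed.

End Transfer.

Section Exchange.

Variables (F : fieldType) (q p : F).

Hypothesis q_neq0 : q != 0.
Hypothesis sq2 : sigma (q ^+ 2) != 0.
Hypothesis sq4 : sigma (q ^+ 4) != 0.
Hypothesis p_neq0 : p != 0.

Local Notation bulk_wt := (bulk_wt q).
Local Notation left_wt := (left_wt q p).
Local Notation right_wt := (right_wt q p).
Local Notation half_row := (half_row q p).
Local Notation full_row := (full_row q p).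
Local Notation triangle_sum := (triangle_sum q p).
Local Notation rmatrix := (rmatrix q).
Local Notation rmatrix_op := (rmatrix_op q).
Local Notation left_pair := (left_pair q p).
Local Notation right_pair := (right_pair q p).

Lemma sum_pair (V : nmodType) (I J : finType) (f : I * J -> V) :
  \sum_(ij : I * J) f ij = \sum_i \sum_j f (i, j).
Proof. by rewrite pair_big; apply: eq_bigr => -[]. Qed.

Lemma rmatrix_op_half_row (x y z : F) h cs1 cs2 K ts : x != 0 -> y != 0 -> z != 0 ->
  rmatrix_op y z (size cs1) (half_row x h (cs1 ++ y :: z :: cs2) K) ts
  = half_row x h (cs1 ++ z :: y :: cs2) (rmatrix_op y z (size cs1) K) ts.
Proof.
move=> x0 y0 z0; elim: cs1 h K ts => [|c cs1 IH] h K [|t ts] //=.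
  case: ts => [|u ts].
    by rewrite big1 // => k _; rewrite big1 // => b _; rewrite mulr0.
  pose r l c d := half_row x l cs2 (fun bs => K (c :: d :: bs)) ts.
  transitivity (\sum_(l : bool) \sum_(c : bool) \sum_(d : bool)
     (\sum_(e : bool) \sum_(f : bool) \sum_(k : bool)
       rmatrix y z t u e f * bulk_wt (x * y) e c h k * bulk_wt (x * z) f d k l) * r l c d).
    by rewrite /r !big_bool /=; ring.
  transitivity (\sum_(l : bool) \sum_(c : bool) \sum_(d : bool)
     (\sum_(e : bool) \sum_(f : bool) \sum_(k : bool)
       bulk_wt (x * z) t e h k * bulk_wt (x * y) u f k l * rmatrix y z e f c d) * r l c d).
    do 3![apply: eq_bigr => ? _]; congr (_ * _).
    exact: yang_baxter_columns.
  have rE l e f : half_row x l cs2 (fun bs => \sum_(c : bool) \sum_(d : bool)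
      rmatrix y z e f c d * K (c :: d :: bs)) ts
    = \sum_(c : bool) \sum_(d : bool) rmatrix y z e f c d * r l c d.
    under eq_half_row => bs do rewrite pair_big /=.
    by rewrite half_row_lin pair_big.
  under [RHS]eq_bigr => k _ do under eq_bigr => b _ do
    under eq_bigr => l _ do under eq_bigr => b' _ do rewrite rE.
  by rewrite !big_bool /=; ring.
transitivity (rmatrix_op y z (size cs1) (fun s => \sum_(kb : bool * bool)
    bulk_wt (x * c) t kb.2 h kb.1
    * half_row x kb.1 (cs1 ++ y :: z :: cs2) (fun bs => K (kb.2 :: bs)) s) ts).
  by apply: eq_rmatrix_op => s; rewrite pair_big.
rewrite rmatrix_op_lin pair_big /=; apply: eq_bigr => -[k b] _ /=.
by rewrite IH.
Qed.

Lemma rmatrix_op_full_row (x y z : F) cs1 cs2 K ts : x != 0 -> y != 0 -> z != 0 ->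
  rmatrix_op y z (size cs1).+1 (full_row x (cs1 ++ y :: z :: cs2) K) ts
  = full_row x (cs1 ++ z :: y :: cs2) (rmatrix_op y z (size cs1) K) ts.
Proof.
move=> x0 y0 z0; case: ts => //= t ts; rewrite rmatrix_op_lin.
by apply: eq_bigr => h _; rewrite rmatrix_op_half_row.
Qed.

(** Two consecutive rows without their left ends, summed column by column instead of row by row, so
    that [yang_baxter_rows] can act on one column at a time. *)
Fixpoint two_rows x y h g cs (K : seq bool -> F) (ts : seq bool) : F :=
  match cs, ts with
  | [::], [:: c; d] => right_pair x y c d h g * K [::]
  | c :: cs', t :: ts' =>
      \sum_(k : bool) \sum_(l : bool) \sum_(b : bool)
        (\sum_(e : bool) bulk_wt (x * c) t e h k * bulk_wt (y * c) e b g l)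
        * two_rows x y k l cs' (fun bs => K (b :: bs)) ts'
  | _, _ => 0
  end.

Lemma two_rowsE x y h g cs K ts :
  half_row x h (cs ++ [:: y]) (half_row y g cs K) ts = two_rows x y h g cs K ts.
Proof.
elim: cs h g K ts => [|c cs IH] h g K [|t ts] //=.
  case: ts => [|d [|? ?]] /=; rewrite /right_pair ?big_bool /=; ring.
transitivity (\sum_(k : bool) \sum_(e : bool) bulk_wt (x * c) t e h k *
  \sum_(lb : bool * bool) bulk_wt (y * c) e lb.2 g lb.1
    * two_rows x y k lb.1 cs (fun bs => K (lb.2 :: bs)) ts).
  do 2![apply: eq_bigr => ? _]; congr (_ * _).
  under eq_half_row => bs do rewrite pair_big /=.
  by rewrite half_row_lin; apply: eq_bigr => lb _; rewrite IH.
by rewrite !big_bool !sum_pair !big_bool /=; ring.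
Qed.

(** The crossing of the two rows travels to the right, one column at a time, and leaves at the right
    boundary as a crossing of the last two vertical edges. *)
Lemma two_rows_exchange (x y : F) h g cs K ts : x != 0 -> y != 0 ->
  all (predC1 0) cs ->
  \sum_(k : bool) \sum_(l : bool) rmatrix x y h g k l * two_rows x y k l cs K ts
  = rmatrix_op x y (size cs) (two_rows y x h g cs K) ts.
Proof.
move=> x0 y0; elim: cs h g K ts => [|c cs IH] h g K [|t ts] /=.
- by move=> _; rewrite !big_bool /=; ring.
- case: ts => [|d [|? ?]] /= _; try by rewrite !big_bool /=; ring.
    transitivity ((\sum_(k : bool) \sum_(l : bool)
      rmatrix x y h g k l * right_pair x y t d k l) * K [::]).
      by rewrite !big_bool /=; ring.
    by rewrite right_reflection // !big_bool /=; ring.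
- by move=> _; rewrite !big_bool /=; ring.
case/andP=> c0 cs0.
pose r k l b := two_rows x y k l cs (fun bs => K (b :: bs)) ts.
transitivity (\sum_(k : bool) \sum_(l : bool) \sum_(b : bool)
   (\sum_(e : bool) \sum_(h' : bool) \sum_(g' : bool)
     rmatrix x y h g h' g' * bulk_wt (x * c) t e h' k * bulk_wt (y * c) e b g' l) * r k l b).
  by rewrite /r !big_bool /=; ring.
transitivity (\sum_(k : bool) \sum_(l : bool) \sum_(b : bool)
   (\sum_(e : bool) \sum_(h' : bool) \sum_(g' : bool)
     bulk_wt (y * c) t e h h' * bulk_wt (x * c) e b g g' * rmatrix x y h' g' k l) * r k l b).
  do 3![apply: eq_bigr => ? _]; congr (_ * _).
  exact: yang_baxter_rows.
transitivity (rmatrix_op x y (size cs) (fun s => \sum_(klb : bool * bool * bool)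
    (\sum_(e : bool) bulk_wt (y * c) t e h klb.1.1 * bulk_wt (x * c) e klb.2 g klb.1.2)
    * two_rows y x klb.1.1 klb.1.2 cs (fun bs => K (klb.2 :: bs)) s) ts); last first.
  by apply: eq_rmatrix_op => s; rewrite !pair_big.
rewrite rmatrix_op_lin.
transitivity (\sum_(klb : bool * bool * bool)
    (\sum_(e : bool) bulk_wt (y * c) t e h klb.1.1 * bulk_wt (x * c) e klb.2 g klb.1.2)
    * \sum_(k : bool) \sum_(l : bool) rmatrix x y klb.1.1 klb.1.2 k l * r k l klb.2);
  last by apply: eq_bigr => -[[k l] b] _; rewrite IH.
rewrite !sum_pair.
by rewrite !big_bool /=; ring.
Qed.

Lemma full_row2E x y a b cs K ts :
  full_row x (y :: cs ++ [:: y]) (full_row y cs K) (a :: b :: ts)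
  = \sum_(h : bool) \sum_(g : bool)
      left_pair x y a b h g * two_rows x y h g cs K ts.
Proof.
rewrite /=.
transitivity (\sum_(h : bool) left_wt x a h * \sum_(k : bool) \sum_(e : bool)
  bulk_wt (x * y) b e h k * \sum_(g : bool) left_wt y e g * two_rows x y k g cs K ts).
  apply: eq_bigr => h _; congr (_ * _); do 2![apply: eq_bigr => ? _].
  by rewrite half_row_lin; under eq_bigr do rewrite two_rowsE.
by rewrite /left_pair !big_bool /=; ring.
Qed.

Lemma full_row2_exchange (x y : F) cs K ts : x != 0 -> y != 0 ->
  all (predC1 0) cs ->
  rmatrix_op x y 0 (full_row x (y :: cs ++ [:: y]) (full_row y cs K)) ts
  = rmatrix_op x y (size cs).+2 (full_row y (x :: cs ++ [:: x]) (full_row x cs K)) ts.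
Proof.
move=> x0 y0 cs0; case: ts => [|a [|b ts]] //.
transitivity (\sum_(hg : bool * bool) left_pair y x a b hg.1 hg.2 *
  rmatrix_op x y (size cs) (two_rows y x hg.1 hg.2 cs K) ts); last first.
  rewrite -rmatrix_op_lin; apply: eq_rmatrix_op => s; rewrite full_row2E.
  by rewrite pair_big.
transitivity (\sum_(hg : bool * bool) left_pair y x a b hg.1 hg.2 *
  \sum_(k : bool) \sum_(l : bool) rmatrix x y hg.1 hg.2 k l * two_rows x y k l cs K ts);
  last by apply: eq_bigr => -[k l] _; rewrite two_rows_exchange.
rewrite sum_pair /=.
transitivity (\sum_(k : bool) \sum_(l : bool)
  (\sum_(h : bool) \sum_(g : bool) left_pair y x a b h g * rmatrix x y h g k l)
  * two_rows x y k l cs K ts); last first.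
  by rewrite !big_bool /=; ring.
transitivity (\sum_(k : bool) \sum_(l : bool)
  (\sum_(h : bool) \sum_(g : bool) rmatrix x y a b h g * left_pair x y h g k l)
  * two_rows x y k l cs K ts); last first.
  by do 2![apply: eq_bigr => ? _]; rewrite left_reflection.
transitivity (\sum_(h : bool) \sum_(g : bool) rmatrix x y a b h g *
  full_row x (y :: cs ++ [:: y]) (full_row y cs K) (h :: g :: ts)); first by [].
under eq_bigr => h _ do under eq_bigr => g _ do rewrite full_row2E.
by rewrite !big_bool /=; ring.
Qed.

(** A crossing of the columns x and y sinks through the rows [us1], runs along the rows x and y from
    the left boundary to the right one, and rises through the mirror images of these columns. The
    index on the right is the mirror image of the positions [size us1] and [size us1 + 1]. *)
Lemma triangle_sum_exchange (x y : F) us1 us2 ts :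
  all (predC1 0) (us1 ++ x :: y :: us2) ->
  rmatrix_op x y (size us1) (triangle_sum (us1 ++ x :: y :: us2)) ts
  = rmatrix_op x y (size us1 + (size us2 + (size us2).+3))
      (triangle_sum (us1 ++ y :: x :: us2)) ts.
Proof.
elim: us1 ts => [|u us1 IH] ts; first move=> /= /and3P[x0 y0 us0].
  have pal0 : all (predC1 0) (us2 ++ p :: rev us2).
    by rewrite all_cat /= all_rev us0 p_neq0.
  rewrite /= add0n !rev_cons -!rcons_cons -!rcons_cat -!cats1.
  have -> : (size us2 + (size us2).+3)%N = (size (us2 ++ p :: rev us2)).+2.
    by rewrite size_cat /= size_rev !addnS.
  exact: full_row2_exchange.
rewrite cat_cons [all _ _]/=; case/andP=> u0 us0.
have /and3P[x0 y0 us20] : all (predC1 0) (x :: y :: us2).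
  by move: us0; rewrite all_cat => /andP[].
pose pal us := us ++ p :: rev us.
change (rmatrix_op x y (size us1).+1 (full_row u (pal (us1 ++ x :: y :: us2))
    (triangle_sum (us1 ++ x :: y :: us2))) ts
  = rmatrix_op x y (size us1 + (size us2 + (size us2).+3)).+1
    (full_row u (pal (us1 ++ y :: x :: us2)) (triangle_sum (us1 ++ y :: x :: us2))) ts).
rewrite /pal -[in LHS]catA rmatrix_op_full_row //.
rewrite (eq_full_row _ _ _ _ _ (fun ts' => IH ts' us0)).
set us' := us1 ++ y :: x :: us2.
pose cs1 := us1 ++ y :: x :: us2 ++ p :: rev us2.
have -> : us' ++ p :: rev us' = cs1 ++ x :: y :: rev us1.
  by rewrite /us' /cs1 rev_cat !rev_cons -!cats1 -!catA /= -!catA.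
have -> : (size us1 + (size us2 + (size us2).+3))%N = size cs1.
  by rewrite /cs1 !size_cat /= size_cat /= size_rev !addnS.
rewrite rmatrix_op_full_row //; congr full_row.
by rewrite /cs1 rev_cat !rev_cons -!cats1 -!catA /= -!catA.
Qed.

End Exchange.

(** * Symmetry, and specializations that freeze the outer rows *)

Arguments bulk_wt : simpl never.
Arguments left_wt : simpl never.
Arguments right_wt : simpl never.

Section Specializations.

Variables (F : fieldType) (q p : F).
Hypothesis q_neq0 : q != 0.
Hypothesis sq2 : sigma (q ^+ 2) != 0.
Hypothesis sq4 : sigma (q ^+ 4) != 0.
Hypothesis p_neq0 : p != 0.
Local Notation bulk_wt := (bulk_wt q).
Local Notation left_wt := (left_wt q p).
Local Notation right_wt := (right_wt q p).
Local Notation half_row := (half_row q p).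
Local Notation full_row := (full_row q p).
Local Notation triangle_sum := (triangle_sum q p).
Local Notation rmatrix := (rmatrix q).
Local Notation rmatrix_op := (rmatrix_op q).

Local Notation ups n := (nseq n true).

Definition top_up_sum us := triangle_sum us (ups (size us).*2.+1).

Definition pal us := us ++ p :: rev us.

Lemma sum_bool (f : bool -> F) : \sum_(b : bool) f b = f true + f false.
Proof. exact: big_bool. Qed.

Lemma size_pal us : size (pal us) = (size us).*2.+1.
Proof. by rewrite size_cat /= size_rev addnS addnn. Qed.

(** The R-matrix preserves the number of upward edges, so two of them can only go to themselves. Its
    single entry there becomes the common factor cancelled in [top_up_sum_swap]. *)
Lemma rmatrix_op_ups x y k m K : (k.+1 < m)%N ->
  rmatrix_op x y k K (ups m) = sigma (q ^+ 4 * y / x) * K (ups m).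
Proof.
elim: k m K => [|k IH] [|[|m]] // K; last by move=> km; rewrite /= (IH m.+1).
by rewrite /= !big_bool /= !mul0r !addr0.
Qed.

Lemma top_up_sum_swap (x y : F) us1 us2 : all (predC1 0) (us1 ++ x :: y :: us2) ->
  sigma (q ^+ 4 * y / x) != 0 ->
  top_up_sum (us1 ++ x :: y :: us2) = top_up_sum (us1 ++ y :: x :: us2).
Proof.
move=> us0 s0; rewrite /top_up_sum.
have -> : size (us1 ++ y :: x :: us2) = size (us1 ++ x :: y :: us2).
  by rewrite !size_cat.
set m := (size _).*2.+1.
have := triangle_sum_exchange q_neq0 sq2 sq4 p_neq0 (ups m) us0.
rewrite !rmatrix_op_ups; first exact: mulfI.
  rewrite /m size_cat /= -addnn; lia.
by rewrite /m size_cat /= -addnn; lia.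
Qed.

Lemma top_up_sum_move_last (x : F) us1 us2 : all (predC1 0) (us1 ++ x :: us2) ->
  (forall u, u \in us2 -> sigma (q ^+ 4 * u / x) != 0) ->
  top_up_sum (us1 ++ x :: us2) = top_up_sum (us1 ++ us2 ++ [:: x]).
Proof.
elim: us2 us1 => [|y us2 IH] us1 us0 xus //.
rewrite top_up_sum_swap //; last by apply: xus; rewrite inE eqxx.
rewrite -cat_rcons IH ?cat_rcons // => [|u uus2]; last first.
  by apply: xus; rewrite inE uus2 orbT.
by move: us0; rewrite !all_cat /= => /and4P[-> -> -> ->].
Qed.

Lemma top_up_sum_move_first (x : F) us1 us2 us3 :
  all (predC1 0) (us1 ++ us2 ++ x :: us3) ->
  (forall u, u \in us2 -> sigma (q ^+ 4 * x / u) != 0) ->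
  top_up_sum (us1 ++ us2 ++ x :: us3) = top_up_sum (us1 ++ x :: us2 ++ us3).
Proof.
elim: us2 us1 => [|y us2 IH] us1 us0 xus //.
move: us0; rewrite !cat_cons -cat_rcons => us0; rewrite IH //; last first.
  by move=> u uus2; apply: xus; rewrite inE uus2 orbT.
move: us0; rewrite !cat_rcons => us0.
rewrite top_up_sum_swap //; last by apply: xus; rewrite inE eqxx.
by move: us0; rewrite !all_cat /= !all_cat /= => /and5P[-> -> -> -> ->].
Qed.

(** At each bulk vertex the edges going up and left are both outgoing, so the other two have to be
    incoming, and the row is frozen. *)
Lemma half_row_left x cs K t :
  half_row x false cs K (ups (size cs) ++ [:: t])
  = (\prod_(c <- cs) bulk_wt (x * c) true true false false) * right_wt x t false
    * K (ups (size cs)).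
Proof.
elim: cs K => [|c cs IH] K /=; first by rewrite big_nil mul1r.
by rewrite big_cons !big_bool /= IH /bulk_wt /=; ring.
Qed.

Lemma half_row_right_cons x c cs K ts :
  half_row x true (c :: cs) K (true :: ts)
  = bulk_wt (x * c) true true true true
      * half_row x true cs (fun bs => K (true :: bs)) ts
    + half_row x false cs (fun bs => K (false :: bs)) ts.
Proof. by rewrite /= !big_bool /= /bulk_wt /=; ring. Qed.

(** The row can turn from right to left at most once, after which it is frozen by [half_row_left].
    [X] collects the contributions with such a turn; the point is that it does not depend on [t]. *)
Lemma half_row_right x cs K : exists X, forall t,
  half_row x true cs K (ups (size cs) ++ [:: t])
  = X * right_wt x t false
    + (\prod_(c <- cs) bulk_wt (x * c) true true true true) * K (ups (size cs))
      * right_wt x t true.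
Proof.
elim: cs K => [|c cs IH] K.
  by exists 0 => u; rewrite /= big_nil; ring.
have [X XE] := IH (fun bs => K (true :: bs)).
exists (bulk_wt (x * c) true true true true * X
  + (\prod_(d <- cs) bulk_wt (x * d) true true false false)
    * K (false :: ups (size cs))) => u.
rewrite [size _]/= [ups _ ++ _]/= half_row_right_cons XE half_row_left big_cons.
ring.
Qed.

Lemma ups_rcons m : ups m.+1 = ups m ++ [:: true].
Proof. by rewrite -[[:: true]]/(ups 1) -nseqD addn1. Qed.

Lemma top_up_sum_cons x us :
  top_up_sum (x :: us)
  = \sum_(h : bool) left_wt x true h
    * half_row x h (pal us) (triangle_sum us) (ups (size (pal us)) ++ [:: true]).
Proof. by rewrite -ups_rcons size_pal. Qed.

Lemma top_up_sum_left x us : left_wt x true true = 0 ->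
  top_up_sum (x :: us) = left_wt x true false
    * (\prod_(c <- pal us) bulk_wt (x * c) true true false false) * right_wt x true false
    * top_up_sum us.
Proof.
move=> lx; rewrite top_up_sum_cons sum_bool lx half_row_left size_pal -/(top_up_sum us).
by ring.
Qed.

(** A row that turns, or points left from the start, ends with the weight [right_wt x true false];
    only the row pointing right throughout survives. *)
Lemma top_up_sum_right x us : right_wt x true false = 0 ->
  top_up_sum (x :: us) = left_wt x true true
    * (\prod_(c <- pal us) bulk_wt (x * c) true true true true) * right_wt x true true
    * top_up_sum us.
Proof.
move=> rx; rewrite top_up_sum_cons sum_bool half_row_left rx.
have [X ->] := half_row_right x (pal us) (triangle_sum us).
by rewrite rx size_pal -/(top_up_sum us); ring.
Qed.

Lemma pal_cons y us : pal (y :: us) = y :: pal us ++ [:: y].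
Proof. by rewrite /pal rev_cons -cats1 /= -catA. Qed.

(* By the first hypothesis at most the first horizontal edge of the outer row
   points right; by the second one the contributions in which the first
   horizontal edge of the next row points right cancel. *)
Lemma top_up_sum_left2 (x y : F) us : bulk_wt (x * y) true true true true = 0 ->
  left_wt x true false * bulk_wt (x * y) true true false false * left_wt y true true
    + left_wt x true true * left_wt y false true = 0 ->
  top_up_sum (x :: y :: us) =
    left_wt x true false * left_wt y true false * right_wt x true false * right_wt y true false
    * bulk_wt (x * y) true true false false ^+ 2
    * (\prod_(c <- pal us) (bulk_wt (x * c) true true false false
                             * bulk_wt (y * c) true true false false))
    * top_up_sum us.
Proof.
move=> bxy lxy; rewrite top_up_sum_cons sum_bool pal_cons.
rewrite [size _]/= [ups _ ++ _]/= half_row_right_cons bxy mul0r add0r.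
rewrite -cat_cons half_row_left.
set hr := half_row y true (pal us) (triangle_sum us) (ups (size (pal us)) ++ [:: true]).
set Px := \prod_(c <- pal us) bulk_wt (x * c) true true false false.
set Py := \prod_(c <- pal us) bulk_wt (y * c) true true false false.
have pfy t : triangle_sum (y :: us) (t :: ups (size (pal us ++ [:: y])))
    = left_wt y t true * hr + left_wt y t false * (Py * right_wt y true false * top_up_sum us).
  rewrite size_cat addn1 ups_rcons /hr /Py /top_up_sum -size_pal -half_row_left.
  exact: (sum_bool (fun h => left_wt y t h * half_row y h _ _ _)).
rewrite [\prod_(c <- _) (_ * _)]big_split [_ (\prod_(c <- _) _) _]/= -/Px -/Py.
rewrite !half_row_left !pfy big_cons big_cat big_seq1 /= -/Px.
have -> : left_wt y false false = 0 by [].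
set b := bulk_wt (x * y) _ _ _ _ in lxy *.
apply/eqP; rewrite -subr_eq0; apply/eqP.
(* The difference of the two sides is a multiple of the left-hand side of [lxy]. *)
transitivity ((left_wt x true false * b * left_wt y true true
  + left_wt x true true * left_wt y false true) * (b * Px * right_wt x true false * hr)).
  by ring.
by rewrite lxy mul0r.
Qed.

(** Mirror image of [top_up_sum_left2]: the outer row may turn left only at its last bulk vertex,
    and the contributions in which the next row ends with an edge pointing left cancel by the second
    hypothesis. *)
Lemma top_up_sum_right2 (x y : F) us : bulk_wt (x * y) true true false false = 0 ->
  bulk_wt (x * y) true true true true * right_wt x true true * right_wt y true false
    + right_wt x true false * right_wt y false false = 0 ->
  top_up_sum (x :: y :: us) =
    left_wt x true true * left_wt y true true * right_wt x true true * right_wt y true true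
    * bulk_wt (x * y) true true true true ^+ 2
    * (\prod_(c <- pal us) (bulk_wt (x * c) true true true true
                             * bulk_wt (y * c) true true true true))
    * top_up_sum us.
Proof.
move=> bxy rxy; rewrite top_up_sum_cons sum_bool pal_cons half_row_left.
rewrite big_cons bxy !mul0r mulr0 addr0.
have right_only (cs : seq F) K : half_row x true (cs ++ [:: y]) K
      (ups (size (cs ++ [:: y])) ++ [:: true])
    = (\prod_(c <- cs) bulk_wt (x * c) true true true true) *
      (bulk_wt (x * y) true true true true * right_wt x true true
         * K (ups (size cs) ++ [:: true])
       + right_wt x true false * K (ups (size cs) ++ [:: false])).
  elim: cs K => [|c cs IH] K.
    rewrite big_nil cat0s [size _]/= [ups _ ++ _]/= half_row_right_cons /=.
    by ring.
  rewrite [size _]/= [ups _ ++ _]/= cat_cons half_row_right_cons IH big_cons.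
  rewrite half_row_left big_cat big_seq1 /= bxy.
  by ring.
rewrite -cat_cons right_only big_cons.
rewrite [\prod_(c <- _) (_ * _)]big_split [_ (\prod_(c <- _) _) _]/=.
set Px := \prod_(c <- pal us) bulk_wt (x * c) true true true true.
set Py := \prod_(c <- pal us) bulk_wt (y * c) true true true true.
have [X XE] := half_row_right y (pal us) (triangle_sum us).
have pfy t : triangle_sum (y :: us) (true :: ups (size (pal us)) ++ [:: t])
    = left_wt y true true * (X * right_wt y t false + Py * top_up_sum us * right_wt y t true)
      + left_wt y true false * ((\prod_(c <- pal us) bulk_wt (y * c) true true false false)
                           * right_wt y t false * top_up_sum us).
  rewrite /top_up_sum -size_pal -XE -half_row_left.
  exact: (sum_bool (fun h => left_wt y true h * half_row y h _ _ _)).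
rewrite !pfy.
have -> : right_wt y false true = 0 by [].
set PB := \prod_(c <- _) _.
set b := bulk_wt (x * y) _ _ _ _ in rxy *.
apply/eqP; rewrite -subr_eq0; apply/eqP.
transitivity ((b * right_wt x true true * right_wt y true false
  + right_wt x true false * right_wt y false false) * (left_wt x true true * b * Px *
    (left_wt y true true * X + left_wt y true false * PB * top_up_sum us))).
  by ring.
by rewrite rxy mul0r.
Qed.

Lemma triangle_sum_eq0 us1 us2 ts :
  triangle_sum us2 =1 (fun=> 0) -> triangle_sum (us1 ++ us2) ts = 0.
Proof.
move=> pf0; elim: us1 ts => [|u us1 IH] ts //=.
rewrite (eq_full_row _ _ _ _ _ IH); case: ts => //= t ts.
rewrite big1 // => h _.
(* The zero function is written as an empty linear combination, to which [half_row_lin] applies. *)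
rewrite (@eq_half_row _ _ _ _ _ _ _ (fun=> \sum_(i : 'I_0) 0 * 0)).
  by rewrite half_row_lin big_ord0 mulr0.
by move=> bs; rewrite big_ord0.
Qed.

(** The innermost row crosses only the middle column, of parameter [p]. Its sum vanishes for each of
    the eight patterns of its three top edges, hence so does everything built on top of it. *)
Lemma top_up_sum_last_eq0 (x e : F) us : x != 0 -> e ^+ 2 = 1 ->
  x * p = e * q ^+ 2 \/ x * p = e * q ^- 2 -> top_up_sum (us ++ [:: x]) = 0.
Proof.
move=> x0 e1 xp; apply: triangle_sum_eq0 => ts.
have {xp} : p = e * q ^+ 2 / x \/ p = e * q ^- 2 / x.
  by case: xp => [<-|<-]; [left|right]; field.
have : e = 1 \/ e = -1.
  by move/eqP: e1; rewrite -[X in _ == X](expr1n _ 2) eqf_sqr => /orP[] /eqP; auto.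
case: ts => [|a [|b [|c [|d ts]]]] //=; rewrite !sum_bool.
1,2,4: by move=> _ _; ring.
rewrite /left_wt /right_wt /bulk_wt /bulk_weight => -[] -> [] ->.
all: case: a; case: b; case: c; simpl; rewrite /sigma.
all: by field; rewrite ?q_neq0 ?x0 ?(q4_sub1_neq0 q_neq0 sq2)
  ?(q8_sub1_neq0 q_neq0 sq4) ?oppr_eq0 ?oner_neq0.
Qed.

End Specializations.

(** * The Schur function as a ratio of alternants *)

Section Alternants.

Variable F : fieldType.
Implicit Types (e : nat -> nat) (xs ys : seq F).

Definition alternant e xs : F :=
  \det (\matrix_(i < size xs, j < size xs) xs`_i ^+ e j).

(* 0, 1, 3, 4, 6, 7, ...: the exponents of the numerator alternant of
   s_(n-1,n-1,...,1,1), in increasing order. *)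
Definition stair (j : nat) : nat := 3 * j./2 + odd j.

Definition stair_schur xs : F := alternant stair xs / alternant id xs.

(** The sign is chosen before [e], so that it cancels in a ratio of alternants. *)
Lemma alternant_perm xs ys : perm_eq xs ys ->
  exists s : bool, forall e, alternant e xs = (-1) ^+ s * alternant e ys.
Proof.
move=> xys; have /tuple_permP[s xsE] : perm_eq xs (in_tuple ys) by [].
exists (odd_perm s) => e; rewrite /alternant -det_perm -det_mulmx -row_permE.
have sz : size xs = size ys by rewrite (perm_size xys).
rewrite {}sz; congr (\det _); apply/matrixP => i j; rewrite !mxE.
congr (_ ^+ _); rewrite xsE (nth_map i) ?size_enum_ord //.
by rewrite nth_ord_enum (tnth_nth 0).
Qed.

Lemma stair_schur_perm xs ys : perm_eq xs ys -> stair_schur xs = stair_schur ys.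
Proof.
move=> /alternant_perm[s xys]; rewrite /stair_schur !xys.
by rewrite -mulf_div divff ?mul1r // signr_eq0.
Qed.

Lemma alternant_id xs :
  alternant id xs = \prod_(i < size xs) \prod_(j < size xs | (i < j)%N) (xs`_j - xs`_i).
Proof.
pose a : 'rV[F]_(size xs) := \row_i xs`_i.
transitivity (\det (Vandermonde (size xs) a)).
  by rewrite -det_tr; congr (\det _); apply/matrixP => i j; rewrite !mxE.
rewrite det_Vandermonde; apply: eq_bigr => i _; apply: eq_bigr => j _.
by rewrite !mxE.
Qed.

Lemma alternant_id_cons a xs :
  alternant id (a :: xs) = \prod_(y <- xs) (y - a) * alternant id xs.
Proof.
rewrite !alternant_id /= big_ord_recl big_mkcond big_ord_recl /= mul1r.
congr (_ * _); first by rewrite (big_nth 0) big_mkord.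
apply: eq_bigr => i _; rewrite big_mkcond big_ord_recl /= mul1r.
by rewrite [RHS]big_mkcond; apply: eq_bigr => j _.
Qed.

Lemma alternant_id_neq0 xs : uniq xs -> alternant id xs != 0.
Proof.
elim: xs => [|x xs IH]; first by rewrite alternant_id big_ord0 oner_neq0.
move=> /= /andP[xxs uxs]; rewrite alternant_id_cons mulf_neq0 ?IH //.
rewrite prodf_seq_neq0; apply/allP => y yxs /=; rewrite subr_eq0.
by apply: contraNneq xxs => <-.
Qed.

Lemma stairSS j : stair j.+2 = (stair j + 3)%N.
Proof. by rewrite /stair /= negbK; lia. Qed.

Lemma det2 (A : 'M[F]_2) : \det A = A 0 0 * A 1 1 - A 0 1 * A 1 0.
Proof.
rewrite (expand_det_row _ 0) !big_ord_recl big_ord0 /cofactor !det_mx11 !mxE /=.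
rewrite addr0 expr0 expr1 mul1r mulN1r mulrN; congr (_ * A _ _ - A _ _ * A _ _);
  exact/val_inj.
Qed.

(** As [stair j.+2 = stair j + 3], subtracting a^3 times column j - 2 from column j multiplies the
    old entry of y in column j - 2 by y^3 - a^3. This kills the rows of a and b outside the first
    two columns, where the block with rows (1, a) and (1, b) remains. *)
Lemma alternant_stair_cons2 a b xs : a ^+ 3 = b ^+ 3 ->
  alternant stair [:: a, b & xs]
  = (b - a) * \prod_(y <- xs) (y ^+ 3 - a ^+ 3) * alternant stair xs.
Proof.
move=> ab; pose m := size xs.
pose A : 'M[F]_(2 + m) :=
  \matrix_(i < 2 + m, j < 2 + m) [:: a, b & xs]`_i ^+ stair j.
(* A *m U subtracts a ^+ 3 times column j - 2 from column j. *)
pose U : 'M[F]_(2 + m) :=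
  \matrix_(i, j) ((i == j)%:R - a ^+ 3 *+ (i.+2 == j :> nat)).
have detU : \det U = 1.
  rewrite -det_tr det_trig; last first.
    apply/is_trig_mxP => i j ij; rewrite !mxE.
    by rewrite -val_eqE /= gtn_eqF // gtn_eqF ?mulr0n ?subr0 //; lia.
  by apply: big1 => i _; rewrite !mxE eqxx gtn_eqF ?mulr0n ?subr0 //; lia.
pose B : 'M[F]_2 := \matrix_(i, j) [:: a; b]`_i ^+ j.
pose C : 'M[F]_m := \matrix_(i, j) xs`_i ^+ stair j.
pose D : 'M[F]_m := diag_mx (\row_i (xs`_i ^+ 3 - a ^+ 3)).
have AU i (j : 'I_(2 + m)) : (A *m U) i j
    = A i j - (if (j < 2)%N then 0 else a ^+ 3 * [:: a, b & xs]`_i ^+ stair j.-2).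
  rewrite !mxE; under eq_bigr => k _ do rewrite !mxE mulrBr.
  rewrite sumrB (bigD1 j) //= eqxx mulr1 big1 ?addr0 => [|k /negPf ->]; last first.
    by rewrite mulr0.
  congr (_ - _); case: ltnP => [j2|j2].
    by apply: big1 => k _; rewrite gtn_eqF ?mulr0n ?mulr0 //; lia.
  have j2' : (j.-2 < 2 + m)%N by have := ltn_ord j; lia.
  rewrite (bigD1 (Ordinal j2')) //= big1 ?addr0 => [|k kj].
    by rewrite (_ : (j.-2.+2 == j) = true) 1?mulrC //; apply/eqP; lia.
  rewrite [k.+2 == j](negPf _) ?mulr0n ?mulr0 //.
  by apply: contraNneq kj => kj; apply/eqP/val_inj => /=; lia.
have AUE : A *m U = block_mx B 0 (dlsubmx (A *m U)) (D *m C).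
  rewrite -[LHS]submxK; congr block_mx; apply/matrixP => i j.
  - rewrite [LHS]mxE [LHS]mxE AU (ltn_ord j : (lshift m j < 2)%N) subr0 !mxE /=.
    have -> : stair j = j by case: j => -[|[|]].
    by case: i => -[|[|]].
  - rewrite [LHS]mxE [LHS]mxE AU !mxE /= stairSS exprD.
    case: i => -[|[|]] //= _; rewrite ?ab; ring.
  - rewrite mul_diag_mx [LHS]mxE [LHS]mxE AU !mxE /= stairSS exprD; ring.
rewrite /alternant -/A; have -> : \det A = \det (A *m U).
  by rewrite det_mulmx detU mulr1.
rewrite AUE det_lblock det_mulmx det_diag det2 !mxE /= expr0 expr1.
rewrite !mul1r mulrA; congr (_ * _ * _); rewrite ?mulr1 //.
by rewrite (big_nth 0) big_mkord; apply: eq_bigr => i _; rewrite mxE.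
Qed.

(** The hypothesis gives y^3 - a^3 = (y - a)(y - b)(y + a + b); the first two factors cancel against
    the Vandermonde determinant. *)
Lemma stair_schur_cons2 a b xs : uniq [:: a, b & xs] ->
  a ^+ 2 + a * b + b ^+ 2 = 0 ->
  stair_schur [:: a, b & xs] = \prod_(y <- xs) (y + a + b) * stair_schur xs.
Proof.
move=> uabx ab0; have ab : a ^+ 3 = b ^+ 3.
  apply/eqP; rewrite -subr_eq0.
  have -> : a ^+ 3 - b ^+ 3 = (a - b) * (a ^+ 2 + a * b + b ^+ 2) by ring.
  by rewrite ab0 mulr0.
have := alternant_id_neq0 uabx.
rewrite /stair_schur alternant_stair_cons2 // !alternant_id_cons big_cons.
rewrite !mulf_eq0 !negb_or => /and3P[/andP[ba0 ya0] yb0 x0].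
have -> : \prod_(y <- xs) (y ^+ 3 - a ^+ 3)
    = \prod_(y <- xs) (y - a) * \prod_(y <- xs) (y - b) * \prod_(y <- xs) (y + a + b).
  rewrite -!big_split; apply: eq_bigr => y _ /=.
  have -> : (y - a) * (y - b) * (y + a + b) = y ^+ 3 - a ^+ 3
    - y * (a ^+ 2 + a * b + b ^+ 2) + a * (a ^+ 2 + a * b + b ^+ 2) by ring.
  by rewrite ab0 !mulr0 subr0 addr0.
by field; rewrite ba0 ya0 yb0 x0.
Qed.

Lemma det_rev (R : comPzRingType) m (A : 'M[R]_m) :
  \det (\matrix_(i, j) A (rev_ord i) (rev_ord j)) = \det A.
Proof.
pose s := perm (@rev_ord_inj m).
have -> : \matrix_(i, j) A (rev_ord i) (rev_ord j) = row_perm s (col_perm s A).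
  by apply/matrixP => i j; rewrite !mxE !permE.
rewrite row_permE col_permE !det_mulmx !det_perm odd_permV mulrCA.
by rewrite -signr_addb addbb mulr1.
Qed.

(** [schur] lists the exponents in decreasing order and [alternant stair] in increasing order;
    reversing rows and columns together costs no sign. *)
Lemma schur_double_staircase n xs : size xs = n.*2 ->
  schur (double_staircase n) xs = stair_schur xs.
Proof.
move=> sz; rewrite -(@stair_schur_perm (rev xs)) ?perm_rev // /schur /stair_schur.
congr (_ / _).
  rewrite -det_rev /alternant.
  rewrite (_ : size (rev xs) = size xs); last exact: size_rev.
  congr (\det _); apply/matrixP => i j; rewrite !mxE nth_rev //.
  congr (_ ^+ _); rewrite /= /double_staircase.
  have := ltn_ord j; have [jn|jn] := ltnP (size xs - j.+1) n.-1.*2 => jx.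
    by rewrite (nth_map 0%N) ?size_iota // nth_iota // /stair; lia.
  (* The two zero parts that pad the partition give the exponents 0 and 1. *)
  by rewrite nth_default ?size_map ?size_iota // /stair; lia.
rewrite alternant_id (_ : size (rev xs) = size xs); last exact: size_rev.
rewrite [RHS](exchange_big_dep xpredT) //= (reindex_inj rev_ord_inj) /=.
apply: eq_bigr => i _; rewrite (reindex_inj rev_ord_inj) /=.
apply: eq_big => [j|j ij]; first by have := ltn_ord j; have := ltn_ord i; lia.
by rewrite !nth_rev.
Qed.

(** The multiple of row [i1] contributes nothing to the determinant. This extracts a factor from one
    row of a determinant of polynomials. *)
Lemma det_row_dvd (R : comPzRingType) m (A : 'M[R]_m) i0 i1 (k d : R)
    (s : 'I_m -> R) : i0 != i1 -> (forall j, A i0 j = k * A i1 j + d * s j) ->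
  \det A = d * \det (\matrix_(i, j) if i == i0 then s j else A i j).
Proof.
move=> i01 Ai0; set C := \matrix_(i, j) _.
pose B := \matrix_(i, j) if i == i0 then A i1 j else A i j.
have row'E s' : row' i0 (\matrix_(i, j) if i == i0 then s' j else A i j) = row' i0 A.
  by apply/matrixP => i j; rewrite !mxE eq_sym (negPf (neq_lift _ _)).
rewrite (@determinant_multilinear _ _ A B C i0 k d) ?row'E //; last first.
  by apply/rowP => j; rewrite !mxE eqxx Ai0.
rewrite [\det B](determinant_alternate i01) ?mulr0 ?add0r // => j.
by rewrite !mxE eqxx eq_sym (negPf i01).
Qed.

Lemma prod_XsubC_sqr_dvdp (cs : seq F) (P : {poly F}) : uniq cs ->
  (forall c, c \in cs -> ('X - c%:P) ^+ 2 %| P) ->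
  \prod_(c <- cs) ('X - c%:P) ^+ 2 %| P.
Proof.
elim: cs => [|c cs IH] /=; first by rewrite big_nil dvd1p.
move=> /andP[ccs ucs] dvd; rewrite big_cons Gauss_dvdp.
  rewrite dvd ?mem_head // IH // => d dcs; apply: dvd.
  by rewrite inE dcs orbT.
rewrite prodrXl coprimep_expl // coprimep_expr // coprimep_sym coprimep_XsubC.
by rewrite root_prod_XsubC.
Qed.

Lemma stair_leq j k : (j <= k)%N -> (stair j <= stair k)%N.
Proof. by rewrite /stair; lia. Qed.

(* y ^+ stair (size xs).+1 times the alternant of y, y^-1, xs, as a polynomial
   in y. *)
Definition pair_alternant xs : {poly F} :=
  \det (\matrix_(i < (size xs).+2, j < (size xs).+2)
    if i == 0 then 'X ^+ stair j
    else if i == 1 then 'X ^+ (stair (size xs).+1 - stair j)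
    else (xs`_i.-2 ^+ stair j)%:P).

Lemma horner_pair_alternant xs y : y != 0 ->
  (pair_alternant xs).[y]
  = y ^+ stair (size xs).+1 * alternant stair [:: y, y^-1 & xs].
Proof.
move=> y0; rewrite -horner_evalE -det_map_mx; set A := map_mx _ _.
pose B : 'M_((size xs).+2) :=
  \matrix_(i, j) [:: y, y^-1 & xs]`_i ^+ stair j.
(* Multilinearity with second coefficient 0 merely scales row 1, whose entries were multiplied by a
   power of y to become polynomials. *)
rewrite (@determinant_multilinear _ _ A B B 1 (y ^+ stair (size xs).+1) 0).
- by rewrite mul0r addr0.
- apply/rowP => j; rewrite !mxE /= horner_evalE hornerXn mul0r addr0.
  rewrite exprVn expfB_cond ?(negPf y0) //.
  by rewrite add0n stair_leq // -ltnS.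
- apply/matrixP => i j; rewrite !mxE; have := neq_lift 1 i.
  case: (lift 1 i) => -[|[|k]] //= km _; rewrite horner_evalE ?hornerXn //.
  by rewrite hornerC.
- apply/matrixP => i j; rewrite !mxE; have := neq_lift 1 i.
  case: (lift 1 i) => -[|[|k]] //= km _; rewrite horner_evalE ?hornerXn //.
  by rewrite hornerC.
Qed.

Lemma size_pair_alternant xs :
  (size (pair_alternant xs) <= (stair (size xs).+1).*2.+1)%N.
Proof.
apply: leq_trans (size_sum _ _ _) _; apply/bigmax_leqP => s _.
rewrite size_Msign !big_ord_recl !mxE /=.
under eq_bigr => i _ do rewrite mxE /=.
rewrite -rmorph_prod /= mulrA -exprD mulrC mul_polyC.
apply: leq_trans (size_scale_leq _ _) _; rewrite size_polyXn ltnS.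
have /stair_leq := ltn_ord (s ord0); have /stair_leq := ltn_ord (s (lift ord0 ord0)).
have := @stair_leq (s ord0) (size xs).+1.
rewrite -ltnS ltn_ord => /(_ isT).
by lia.
Qed.

Lemma pair_alternant_root xs y : y ^+ 2 = 1 -> root (pair_alternant xs) y.
Proof.
move=> y2; have y0 : y != 0.
  by move: (oner_neq0 F); rewrite -y2 expf_eq0.
have yV : y^-1 = y by apply: (mulfI y0); rewrite divff // -expr2.
rewrite /root horner_pair_alternant // yV alternant_stair_cons2 //.
by rewrite subrr !mul0r mulr0.
Qed.

(* Subtracting from the rows of y and y^-1 suitable multiples of those of c and
   c^-1 makes each of them divisible by 'X - c. *)
Lemma pair_alternant_double_root xs c i j : c != 0 ->
  (i < size xs)%N -> (j < size xs)%N -> i != j -> xs`_i = c -> xs`_j = c^-1 ->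
  ('X - c%:P) ^+ 2 %| pair_alternant xs.
Proof.
move=> c0 iN jN ij xi xj.
pose S n : {poly F} := \sum_(k < n) 'X ^+ (n.-1 - k) * c%:P ^+ k.
have i1N : (i.+2 < (size xs).+2)%N by [].
have j1N : (j.+2 < (size xs).+2)%N by [].
rewrite /pair_alternant.
rewrite (@det_row_dvd _ _ _ 0 (Ordinal i1N) 1 ('X - c%:P) (fun k => S (stair k)))
  //; last first.
  by move=> k; rewrite !mxE /= mul1r -subrXX xi rmorphXn /= addrC subrK.
rewrite (@det_row_dvd _ _ _ 1 (Ordinal j1N) (c ^+ stair (size xs).+1)%:P
  ('X - c%:P) (fun k => S (stair (size xs).+1 - stair k)%N)) //; last first.
  move=> k; rewrite !mxE /= -subrXX xj -polyCM.
  have -> : c ^+ (stair (size xs).+1) * c^-1 ^+ stair k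
      = c ^+ (stair (size xs).+1 - stair k).
    rewrite exprVn expfB_cond ?(negPf c0) //.
    by rewrite add0n stair_leq // -ltnS.
  by rewrite rmorphXn /= addrC subrK.
by rewrite mulrA -expr2 dvdp_mulIl.
Qed.

Definition with_inverses (xs : seq F) := flatten [seq [:: x; x^-1] | x <- xs].

Lemma size_with_inverses xs : size (with_inverses xs) = (size xs).*2.
Proof. by elim: xs => //= x xs ->. Qed.

Lemma nth_with_inverses xs i : (i < size xs)%N ->
  (with_inverses xs)`_(i.*2) = xs`_i /\ (with_inverses xs)`_(i.*2.+1) = (xs`_i)^-1.
Proof. by elim: xs i => [|x xs IH] [|i] //= /IH. Qed.

Lemma perm_with_inverses xs : perm_eq (with_inverses xs) (xs ++ map GRing.inv xs).
Proof.
elim: xs => //= x xs IH; rewrite perm_cons perm_sym perm_catC /= perm_cons.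
by rewrite perm_catC perm_sym.
Qed.

Lemma prod_with_inverses xs y : y != 0 -> 0 \notin xs ->
  \prod_(z <- with_inverses xs) ((z - y) * (z - y^-1))
  = y ^- (size xs).*2 * \prod_(z <- with_inverses xs) (y - z) ^+ 2.
Proof.
move=> y0; elim: xs => [|x xs IH]; first by rewrite !big_nil invr1 mul1r.
rewrite inE negb_or eq_sym => /andP[x0 xs0].
rewrite /= !big_cons IH // !exprS; field.
by rewrite x0 y0 expf_neq0.
Qed.

(** As the other arguments are closed under inversion, the Vandermonde factors involving y or y^-1
    are, up to sign and a power of y, y^2 - 1 times the squares (y - z)^2. All of them divide
    [pair_alternant]. With m = [size xs], its degree is at most 2(3m + 1), and 2 + 4m is divided
    out, which leaves 2m. *)
Lemma stair_schur_laurent (xs : seq F) :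
  uniq ([:: 1; -1] ++ with_inverses xs) -> 0 \notin xs ->
  exists H : {poly F}, (size H <= (size xs).*2.+1)%N /\
    forall y, y != 0 -> uniq [:: y, y^-1 & with_inverses xs] ->
      stair_schur [:: y, y^-1 & with_inverses xs] = y ^- size xs * H.[y].
Proof.
move=> /= /and3P[]; rewrite inE negb_or => /andP[n1 x1] xN1 ux x0.
set ps := with_inverses xs in x1 xN1 ux *.
have psN : size ps = (size xs).*2 := size_with_inverses xs.
have stairN : stair (size ps).+1 = ((size ps).+1 + size xs)%N.
  by rewrite psN /stair; lia.
have dvd_xs : \prod_(c <- ps) ('X - c%:P) ^+ 2 %| pair_alternant ps.
  apply: prod_XsubC_sqr_dvdp => // c.
  rewrite (perm_mem (perm_with_inverses xs)) mem_cat.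
  case/orP=> [cxs|/mapP[b bxs ->]].
    have ixs : (index c xs < size xs)%N by rewrite index_mem.
    have [] := nth_with_inverses ixs; rewrite nth_index // => e1 e2.
    apply: (pair_alternant_double_root _ _ _ _ e1 e2).
    - by apply: contraNneq x0 => <-.
    - by rewrite psN; lia.
    - by rewrite psN; lia.
    - by apply/eqP; lia.
  have ixs : (index b xs < size xs)%N by rewrite index_mem.
  have [] := nth_with_inverses ixs; rewrite nth_index // => e1 e2.
  rewrite -[RHS]invrK in e1.
  apply: (pair_alternant_double_root _ _ _ _ e2 e1).
  - by rewrite invr_eq0; apply: contraNneq x0 => <-.
  - by rewrite psN; lia.
  - by rewrite psN; lia.
  - by apply/eqP; lia.
pose D : {poly F} := \prod_(c <- ps) ('X - c%:P) ^+ 2.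
have /dvdpP[H HE] : ('X - 1%:P) * (('X - (-1)%:P) * D) %| pair_alternant ps.
  have coD c : c \notin ps -> coprimep ('X - c%:P) D.
    move=> cps; rewrite /D prodrXl coprimep_expr // coprimep_sym.
    by rewrite coprimep_XsubC root_prod_XsubC.
  rewrite Gauss_dvdp; last first.
    by rewrite coprimepMr coD // andbT coprimep_XsubC2 // subr_eq0 eq_sym.
  rewrite dvdp_XsubCl pair_alternant_root ?expr1n //= Gauss_dvdp ?coD //.
  by rewrite dvdp_XsubCl pair_alternant_root ?sqrrN ?expr1n.
have D0 : D != 0.
  by rewrite /D prodrXl expf_neq0 // monic_neq0 // monic_prod_XsubC.
have Q0 : ('X - 1%:P) * (('X - (-1)%:P) * D) != 0.
  by rewrite !mulf_neq0 ?polyXsubC_eq0.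
have sizeD : size D = (size xs).*2.*2.+1.
  have := size_exp (\prod_(c <- ps) ('X - c%:P)) 2.
  rewrite size_prod_XsubC psN -prodrXl -/D /=.
  by move: D0; rewrite -size_poly_gt0; case: (size D) => [|d] // _ /=; lia.
(* The sign comes from y^-1 - y = - y^-1 (y^2 - 1). *)
exists (- (alternant id ps)^-1 *: H); split.
  apply: leq_trans (size_scale_leq _ _) _.
  have := size_pair_alternant ps; rewrite HE.
  have [->|H0] := eqVneq H 0; first by rewrite size_poly0.
  rewrite size_mul // size_mul ?polyXsubC_eq0 ?mulf_neq0 ?polyXsubC_eq0 //.
  rewrite size_mul ?polyXsubC_eq0 // !size_XsubC sizeD psN /stair.
  rewrite (_ : 2%R = 2%N) //; move: (size H) (size xs) => h k.
  by clear; lia.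
move=> y y0 uy; have := @alternant_id_neq0 [:: y, y^-1 & ps] uy.
rewrite /stair_schur.
have -> : alternant stair [:: y, y^-1 & ps]
    = y ^- stair (size ps).+1 * (pair_alternant ps).[y].
  by rewrite horner_pair_alternant // mulKf // expf_neq0.
have -> : alternant id [:: y, y^-1 & ps]
    = - y ^- (size ps).+1 * (y ^+ 2 - 1) * D.[y] * alternant id ps.
  rewrite !alternant_id_cons big_cons /D.
  transitivity ((y^-1 - y)
    * \prod_(z <- ps) ((z - y) * (z - y^-1)) * alternant id ps).
    by rewrite big_split /=; ring.
  rewrite prod_with_inverses // horner_prod psN.
  under [in RHS]eq_bigr => z _ do rewrite horner_exp hornerXsubC.
  by rewrite exprS; field; rewrite y0 expf_neq0.
rewrite HE !(hornerM, hornerXsubC, hornerZ) !mulf_eq0 !negb_or -!andbA.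
move=> /and4P[_ y1 Dy ap].
have -> : y ^- stair (size ps).+1 = (y ^+ (size ps).+1 * y ^+ size xs)^-1.
  by rewrite -exprD stairN.
have := expf_neq0 (size ps).+1 y0; have := expf_neq0 (size xs) y0.
move: (y ^+ size xs) (y ^+ (size ps).+1) (H.[y]) (D.[y]) (alternant id ps) Dy ap y1.
move=> a b h d v d0 v0 y1 a0 b0; field.
by rewrite d0 v0 y1 a0 b0 oppr_eq0 oner_neq0.
Qed.

End Alternants.

(** * Recurrences at the combinatorial point *)

Section SixthRoot.

Variables (F : fieldType) (q p : F).
Hypothesis q4E : q ^+ 4 = q ^+ 2 - 1.
Hypothesis three_neq0 : 3%:R != 0 :> F.
Hypothesis p_neq0 : p != 0.
Local Notation bulk_wt := (bulk_wt q).
Local Notation left_wt := (left_wt q p).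
Local Notation right_wt := (right_wt q p).
Local Notation triangle_sum := (triangle_sum q p).
Local Notation top_up_sum := (top_up_sum q p).
Local Notation pal := (pal p).

Lemma sixth_q_neq0 : q != 0.
Proof.
by apply: contra_eq_neq q4E => ->; rewrite !expr0n sub0r eq_sym oppr_eq0 oner_eq0.
Qed.

Let q0 := sixth_q_neq0.

(** This square root of -3 is the common value of [sigma (q ^+ 2)] and [sigma (q ^+ 4)], the
    denominators of all weights; the powers of 3 originate here. *)
Lemma sixth_sqr : (q ^+ 2 * 2%:R - 1) ^+ 2 = - 3%:R.
Proof. by ring: q4E. Qed.

Lemma sixth_sigma2 : sigma (q ^+ 2) = q ^+ 2 * 2%:R - 1.
Proof. by rewrite /sigma; field: q4E. Qed.

Lemma sixth_sigma4 : sigma (q ^+ 4) = q ^+ 2 * 2%:R - 1.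
Proof. by rewrite /sigma; field: q4E. Qed.

Lemma sixth_s_neq0 : q ^+ 2 * 2%:R - 1 != 0.
Proof. by move: three_neq0; rewrite -oppr_eq0 -sixth_sqr expf_eq0. Qed.

Let s0 := sixth_s_neq0.

Lemma prod_pal (f : F -> F) us :
  \prod_(c <- pal us) f c = f p * \prod_(u <- us) f u ^+ 2.
Proof.
rewrite big_cat big_cons /= prodrXl.
have -> : \prod_(u <- rev us) f u = \prod_(u <- us) f u.
  by apply: perm_big; rewrite perm_rev.
by ring.
Qed.

Definition pfactor x := p ^+ 2 * x ^+ 2 + 1 + p^-1 ^+ 2 * x^-1 ^+ 2.

Definition sqr_seq (us : seq F) := [seq u ^+ 2 | u <- us].

Definition schur_form (us : seq F) : F :=
  3%:R ^- 'C((size us).+1, 2) * (\prod_(u <- us) pfactor u)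
  * stair_schur (with_inverses (sqr_seq us)).

Lemma schur_form_perm us us' : perm_eq us us' -> schur_form us = schur_form us'.
Proof.
move=> uu'; rewrite /schur_form (perm_size uu') (perm_big _ uu').
congr (_ * _); apply: stair_schur_perm.
by apply: perm_flatten; do 2!apply: perm_map.
Qed.

Lemma big_with_inverses (f : F -> F) us :
  \prod_(z <- with_inverses us) f z = \prod_(u <- us) (f u * f u^-1).
Proof.
elim: us => [|u us IH]; first by rewrite !big_nil.
by rewrite /= !big_cons IH mulrA.
Qed.

(** [stair_schur_cons2] is applied to x^2 and its own inverse. The binomial exponent grows by
    [size us + 1]: one factor 1/3 for each remaining parameter and one for [pfactor x]. *)
Lemma schur_form_cons x us a : uniq (with_inverses (sqr_seq (x :: us))) ->
  (x ^+ 2) ^+ 2 + x ^+ 2 * (x ^+ 2)^-1 + (x ^+ 2)^-1 ^+ 2 = 0 ->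
  a = \prod_(u <- us)
    (3^-1 * ((u ^+ 2 + x ^+ 2 + (x ^+ 2)^-1)
             * ((u ^+ 2)^-1 + x ^+ 2 + (x ^+ 2)^-1))) ->
  schur_form (x :: us) = 3^-1 * pfactor x * a * schur_form us.
Proof.
move=> uxs x3 ->; rewrite /schur_form stair_schur_cons2 //.
rewrite big_with_inverses big_map [X in _ = _ * X * _]big_split.
rewrite [X in _ = _ * X * _]/= big_cons.
rewrite big_const_seq count_predT iter_mulr_1.
have -> : 3%:R ^- 'C((size (x :: us)).+1, 2)
    = 3%:R ^- 'C((size us).+1, 2) * 3^-1 ^+ size us * 3^-1 :> F.
  by rewrite -!exprVn binS bin1 exprD exprSr mulrA.
by ring.
Qed.

(** Here [- q ^+ 2] is q^-4, and [q ^+ 2 - 1] in the lemmas for the right node is q^4. The weight is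
    squared because each parameter occurs twice in [pal]. *)
Lemma left_node_bulk (x u : F) : x ^+ 4 = - q ^+ 2 -> x != 0 -> u != 0 ->
  bulk_wt (x * u) true true false false ^+ 2 =
  3^-1 * ((u ^+ 2 + x ^+ 2 + (x ^+ 2)^-1) * ((u ^+ 2)^-1 + x ^+ 2 + (x ^+ 2)^-1)).
Proof.
move=> x4 x0 u0; rewrite /bulk_wt /bulk_weight /= sixth_sigma4 /sigma.
by field: q4E x4; rewrite x0 u0 three_neq0 s0 q0.
Qed.

Lemma left_node_p (x : F) : x ^+ 4 = - q ^+ 2 -> x != 0 ->
  left_wt x true false * bulk_wt (x * p) true true false false * right_wt x true false
  = 3^-1 * pfactor x.
Proof.
move=> x4 x0; rewrite /left_wt /right_wt /bulk_wt /bulk_weight /left_weight /right_weight /=.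
rewrite sixth_sigma4 sixth_sigma2 /sigma /pfactor.
by field: q4E x4; rewrite x0 p_neq0 three_neq0 s0 q0.
Qed.

Lemma right_node_bulk (x u : F) : x ^+ 4 = q ^+ 2 - 1 -> x != 0 -> u != 0 ->
  bulk_wt (x * u) true true true true ^+ 2 =
  3^-1 * ((u ^+ 2 + x ^+ 2 + (x ^+ 2)^-1) * ((u ^+ 2)^-1 + x ^+ 2 + (x ^+ 2)^-1)).
Proof.
move=> x4 x0 u0; rewrite /bulk_wt /bulk_weight /= sixth_sigma4 /sigma.
by field: q4E x4; rewrite x0 u0 three_neq0 s0 q0.
Qed.

Lemma right_node_p (x : F) : x ^+ 4 = q ^+ 2 - 1 -> x != 0 ->
  left_wt x true true * bulk_wt (x * p) true true true true * right_wt x true true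
  = 3^-1 * pfactor x.
Proof.
move=> x4 x0; rewrite /left_wt /right_wt /bulk_wt /bulk_weight /left_weight /right_weight /=.
rewrite sixth_sigma4 sixth_sigma2 /sigma /pfactor.
by field: q4E x4; rewrite x0 p_neq0 three_neq0 s0 q0.
Qed.

Lemma top_up_sum_left_node (x : F) us : x ^+ 4 = - q ^+ 2 -> 0 \notin us -> x != 0 ->
  uniq (with_inverses (sqr_seq (x :: us))) ->
  top_up_sum us = schur_form us -> top_up_sum (x :: us) = schur_form (x :: us).
Proof.
move=> x4 us0 x0 uxs IH.
rewrite top_up_sum_left; last first.
  rewrite /left_wt /= /sigma [X in X / _](_ : _ = 0) ?mul0r //.
  by field: q4E x4; rewrite x0 q0.
rewrite (schur_form_cons uxs _ (erefl _)); last by field: q4E x4; rewrite x0.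
rewrite prod_pal IH -(left_node_p x4 x0).
have -> : \prod_(u <- us) bulk_wt (x * u) true true false false ^+ 2
    = \prod_(u <- us) (3^-1 * ((u ^+ 2 + x ^+ 2 + (x ^+ 2)^-1)
        * ((u ^+ 2)^-1 + x ^+ 2 + (x ^+ 2)^-1))).
  apply: eq_big_seq => u uus; apply: left_node_bulk => //.
  by apply: contraNneq us0 => <-.
by ring.
Qed.

Lemma top_up_sum_right_node (x : F) us : x ^+ 4 = q ^+ 2 - 1 -> 0 \notin us -> x != 0 ->
  uniq (with_inverses (sqr_seq (x :: us))) ->
  top_up_sum us = schur_form us -> top_up_sum (x :: us) = schur_form (x :: us).
Proof.
move=> x4 us0 x0 uxs IH.
rewrite top_up_sum_right; last first.
  rewrite /right_wt /= /sigma [X in X / _](_ : _ = 0) ?mul0r //.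
  by field: q4E x4; rewrite x0 q0.
rewrite (schur_form_cons uxs _ (erefl _)); last by field: q4E x4; rewrite x0.
rewrite prod_pal IH -(right_node_p x4 x0).
have -> : \prod_(u <- us) bulk_wt (x * u) true true true true ^+ 2
    = \prod_(u <- us) (3^-1 * ((u ^+ 2 + x ^+ 2 + (x ^+ 2)^-1)
        * ((u ^+ 2)^-1 + x ^+ 2 + (x ^+ 2)^-1))).
  apply: eq_big_seq => u uus; apply: right_node_bulk => //.
  by apply: contraNneq us0 => <-.
by ring.
Qed.

(** The four arguments are regrouped into the pairs x^2, y^-2 and x^-2, y^2, and [stair_schur_cons2]
    removes one pair after the other. *)
Lemma schur_form_cons2 x y us a :
  uniq (with_inverses (sqr_seq [:: x, y & us])) ->
  (x ^+ 2) ^+ 2 + x ^+ 2 * (y ^+ 2)^-1 + (y ^+ 2)^-1 ^+ 2 = 0 ->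
  (x ^+ 2)^-1 ^+ 2 + (x ^+ 2)^-1 * y ^+ 2 + (y ^+ 2) ^+ 2 = 0 ->
  a = \prod_(u <- us) (3^-1 ^+ 2
    * ((u ^+ 2 + x ^+ 2 + (y ^+ 2)^-1) * ((u ^+ 2)^-1 + x ^+ 2 + (y ^+ 2)^-1)
       * ((u ^+ 2 + (x ^+ 2)^-1 + y ^+ 2) * ((u ^+ 2)^-1 + (x ^+ 2)^-1 + y ^+ 2)))) ->
  schur_form [:: x, y & us] = 3^-1 ^+ 3 * (pfactor x * pfactor y
      * ((x ^+ 2)^-1 + x ^+ 2 + (y ^+ 2)^-1) * (y ^+ 2 + x ^+ 2 + (y ^+ 2)^-1))
    * a * schur_form us.
Proof.
move=> uxys xy yx ->; rewrite /schur_form.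
have perm_xy : perm_eq (with_inverses (sqr_seq [:: x, y & us]))
    [:: x ^+ 2, (y ^+ 2)^-1, (x ^+ 2)^-1, y ^+ 2 & with_inverses (sqr_seq us)].
  rewrite /= perm_cons; apply/seq.permP => P /=.
  by rewrite [RHS]addnCA; congr addn; rewrite addnCA.
rewrite (stair_schur_perm perm_xy).
move: uxys; rewrite (perm_uniq perm_xy) => uxys.
rewrite stair_schur_cons2 // stair_schur_cons2 //; last by case/and3P: uxys.
rewrite !big_cons !big_with_inverses !big_map.
rewrite [X in _ = _ * X * _]big_split [X in _ = _ * X * _]/=.
rewrite [X in _ = _ * (_ * X) * _]big_split [X in _ = _ * X * _]/=.
rewrite big_const_seq count_predT iter_mulr_1.
have -> : 3%:R ^- 'C((size [:: x, y & us]).+1, 2)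
    = 3%:R ^- 'C((size us).+1, 2) * 3^-1 ^+ 2 ^+ size us * 3^-1 ^+ 3 :> F.
  rewrite -!exprVn -exprM -!exprD; congr (_ ^+ _).
  rewrite /= !binS !bin1 !bin0. move: (size us) => n.
  by clear; lia.
by ring.
Qed.

(** Here q^2 x y = e is its own inverse, so the weight proportional to [sigma (q ^+ 2 * (x * y))]
    vanishes, as [top_up_sum_left2] requires. *)
Lemma top_up_sum_left_node2 (x y e : F) us : e ^+ 2 = 1 -> x = e / (q ^+ 2 * y) ->
  0 \notin us -> y != 0 ->
  uniq (with_inverses (sqr_seq [:: x, y & us])) ->
  top_up_sum us = schur_form us -> top_up_sum [:: x, y & us] = schur_form [:: x, y & us].
Proof.
move=> e2 xE us0 y0 uxs IH.
have e0 : e != 0 by move: (oner_neq0 F); rewrite -e2 expf_eq0.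
rewrite top_up_sum_left2; first last.
- rewrite /left_wt /bulk_wt /left_weight /bulk_weight /= xE sixth_sigma2 sixth_sigma4 /sigma.
  by field: q4E e2; rewrite ?e0 ?y0 ?q0 ?s0 ?p_neq0.
- rewrite /bulk_wt /bulk_weight /= xE /sigma [X in X / _](_ : _ = 0) ?mul0r //.
  by field: q4E e2; rewrite ?e0 ?y0 ?q0 ?p_neq0.
have per_u : \prod_(u <- us) (bulk_wt (x * u) true true false false
      * bulk_wt (y * u) true true false false) ^+ 2
    = \prod_(u <- us) (3^-1 ^+ 2
    * ((u ^+ 2 + x ^+ 2 + (y ^+ 2)^-1) * ((u ^+ 2)^-1 + x ^+ 2 + (y ^+ 2)^-1)
       * ((u ^+ 2 + (x ^+ 2)^-1 + y ^+ 2) * ((u ^+ 2)^-1 + (x ^+ 2)^-1 + y ^+ 2)))).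
  apply: eq_big_seq => u uus.
  have u0 : u != 0 by apply: contraNneq us0 => <-.
  rewrite /bulk_wt /bulk_weight /= sixth_sigma4 /sigma xE.
  by field: q4E e2; rewrite ?e0 ?y0 ?u0 ?three_neq0 ?s0 ?q0 ?p_neq0.
rewrite (schur_form_cons2 uxs _ _ per_u); first last.
- by rewrite xE; field: q4E e2; rewrite ?e0 ?y0 ?q0 ?p_neq0.
- by rewrite xE; field: q4E e2; rewrite ?e0 ?y0 ?q0 ?p_neq0.
rewrite prod_pal IH.
have -> : 3^-1 ^+ 3 * (pfactor x * pfactor y
      * ((x ^+ 2)^-1 + x ^+ 2 + (y ^+ 2)^-1) * (y ^+ 2 + x ^+ 2 + (y ^+ 2)^-1))
   = left_wt x true false * left_wt y true false * right_wt x true false * right_wt y true false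
     * bulk_wt (x * y) true true false false ^+ 2
     * (bulk_wt (x * p) true true false false * bulk_wt (y * p) true true false false).
  rewrite /left_wt /right_wt /bulk_wt /bulk_weight /left_weight /right_weight /=.
  rewrite sixth_sigma4 sixth_sigma2 /sigma /pfactor xE.
  by field: q4E e2; rewrite ?e0 ?y0 ?p_neq0 ?three_neq0 ?s0 ?q0.
by ring.
Qed.

Lemma top_up_sum_right_node2 (x y e : F) us : e ^+ 2 = 1 -> x = e * q ^+ 2 / y ->
  0 \notin us -> y != 0 ->
  uniq (with_inverses (sqr_seq [:: x, y & us])) ->
  top_up_sum us = schur_form us -> top_up_sum [:: x, y & us] = schur_form [:: x, y & us].
Proof.
move=> e2 xE us0 y0 uxs IH.
have e0 : e != 0 by move: (oner_neq0 F); rewrite -e2 expf_eq0.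
rewrite top_up_sum_right2; first last.
- rewrite /right_wt /bulk_wt /right_weight /bulk_weight /= xE sixth_sigma2 sixth_sigma4 /sigma.
  by field: q4E e2; rewrite ?e0 ?y0 ?p_neq0 ?q0 ?s0.
- rewrite /bulk_wt /bulk_weight /= xE [sigma (q ^+ 2 / _)](_ : _ = 0) ?mul0r //.
  by rewrite /sigma; field: q4E e2; rewrite e0 y0 q0 oner_neq0.
have per_u : \prod_(u <- us) (bulk_wt (x * u) true true true true
      * bulk_wt (y * u) true true true true) ^+ 2
    = \prod_(u <- us) (3^-1 ^+ 2
    * ((u ^+ 2 + x ^+ 2 + (y ^+ 2)^-1) * ((u ^+ 2)^-1 + x ^+ 2 + (y ^+ 2)^-1)
       * ((u ^+ 2 + (x ^+ 2)^-1 + y ^+ 2) * ((u ^+ 2)^-1 + (x ^+ 2)^-1 + y ^+ 2)))).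
  apply: eq_big_seq => u uus.
  have u0 : u != 0 by apply: contraNneq us0 => <-.
  rewrite /bulk_wt /bulk_weight /= sixth_sigma4 /sigma xE.
  by field: q4E e2; rewrite ?e0 ?y0 ?u0 ?three_neq0 ?s0 ?q0 ?p_neq0.
rewrite (schur_form_cons2 uxs _ _ per_u); first last.
- by rewrite xE; field: q4E e2; rewrite ?e0 ?y0 ?q0 ?p_neq0.
- by rewrite xE; field: q4E e2; rewrite ?e0 ?y0 ?q0 ?p_neq0.
rewrite prod_pal IH.
have -> : 3^-1 ^+ 3 * (pfactor x * pfactor y
      * ((x ^+ 2)^-1 + x ^+ 2 + (y ^+ 2)^-1) * (y ^+ 2 + x ^+ 2 + (y ^+ 2)^-1))
   = left_wt x true true * left_wt y true true * right_wt x true true * right_wt y true true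
     * bulk_wt (x * y) true true true true ^+ 2
     * (bulk_wt (x * p) true true true true * bulk_wt (y * p) true true true true).
  rewrite /left_wt /right_wt /bulk_wt /bulk_weight /left_weight /right_weight /=.
  rewrite sixth_sigma4 sixth_sigma2 /sigma /pfactor xE.
  by field: q4E e2; rewrite ?e0 ?y0 ?p_neq0 ?three_neq0 ?s0 ?q0.
by ring.
Qed.

End SixthRoot.

(** * Interpolation *)

Section Laurent.

Variable F : fieldType.

Definition laurent (m : nat) (f : F -> F) : Prop :=
  exists P : {poly F}, (size P <= m.*2.+1)%N /\
    forall x, x != 0 -> f x = x ^- m * P.[x].

Lemma eq_laurent m f g : f =1 g -> laurent m f -> laurent m g.
Proof. by move=> fg [P [sP fP]]; exists P; split=> // x x0; rewrite -fg fP. Qed.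

Lemma laurent_widen m k f : (m <= k)%N -> laurent m f -> laurent k f.
Proof.
move=> mk [P [sP fP]]; exists ('X^(k - m) * P); split=> [|x x0].
  have [->|P0] := eqVneq P 0; first by rewrite mulr0 size_poly0.
  by rewrite mulrC size_mulXn //; lia.
rewrite fP // hornerM hornerXn mulrA; congr (_ * _).
rewrite expfB_cond ?(negPf x0) ?add0n // mulrA mulVf ?mul1r //.
exact: expf_neq0.
Qed.

Lemma laurent_const m c : laurent m (fun=> c).
Proof.
apply: (@laurent_widen 0%N); first exact: leq0n.
exists c%:P; split=> [|x _]; first by rewrite size_polyC leq_b1.
by rewrite hornerC expr0 invr1 mul1r.
Qed.

Lemma laurent_id : laurent 1 id.
Proof.
exists 'X^2; split=> [|x x0]; first by rewrite size_polyXn.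
by rewrite hornerXn; field.
Qed.

Lemma laurent_inv : laurent 1 GRing.inv.
Proof.
exists 1; split=> [|x x0]; first by rewrite size_poly1.
by rewrite hornerC mulr1.
Qed.

Lemma laurentD m f g : laurent m f -> laurent m g -> laurent m (fun x => f x + g x).
Proof.
move=> [P [sP fP]] [Q [sQ gQ]]; exists (P + Q); split=> [|x x0].
  by rewrite (leq_trans (size_polyD _ _)) // geq_max sP sQ.
by rewrite fP // gQ // hornerD mulrDr.
Qed.

Lemma laurentM m k f g :
  laurent m f -> laurent k g -> laurent (m + k) (fun x => f x * g x).
Proof.
move=> [P [sP fP]] [Q [sQ gQ]]; exists (P * Q); split=> [|x x0].
  apply: leq_trans (size_polyMleq _ _) _; move: sP sQ.
  by move: (size P) (size Q) => i j; clear; lia.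
by rewrite fP // gQ // hornerM exprD; field; rewrite !expf_neq0.
Qed.

Lemma laurentZ m c f : laurent m f -> laurent m (fun x => c * f x).
Proof. by move=> lf; have := laurentM (laurent_const 0 c) lf. Qed.

Lemma laurentB m f g : laurent m f -> laurent m g -> laurent m (fun x => f x - g x).
Proof.
move=> lf /(laurentZ (-1)) lg; apply: eq_laurent (laurentD lf lg) => x.
by rewrite mulN1r.
Qed.

Lemma laurentMr m f c : laurent m f -> laurent m (fun x => f x * c).
Proof. by move/(laurentZ c); apply: eq_laurent => x; rewrite mulrC. Qed.

Lemma laurent_sum (I : finType) m (f : I -> F -> F) :
  (forall i, laurent m (f i)) -> laurent m (fun x => \sum_i f i x).
Proof.
move=> lf; elim: (index_enum I) => [|i r IH].
  by apply: eq_laurent (laurent_const m 0) => x; rewrite big_nil.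
by apply: eq_laurent (laurentD (lf i) IH) => x; rewrite big_cons.
Qed.

Lemma laurent_interpolation m f g (rs : seq F) : laurent m f -> laurent m g ->
  uniq rs -> (m.*2 < size rs)%N -> 0 \notin rs -> {in rs, f =1 g} ->
  forall x, x != 0 -> f x = g x.
Proof.
move=> lf lg urs sz rs0 fg x x0.
have [P [sP fP]] := laurentB lf lg.
suff P0 : P = 0 by apply/eqP; rewrite -subr_eq0 fP // P0 horner0 mulr0.
apply: (roots_geq_poly_eq0 (rs := rs)) => //; last exact: leq_trans sP sz.
apply/allP => r rrs; have r0 : r != 0 by apply: contraNneq rs0 => <-.
have := fP r r0; rewrite fg // subrr => /esym/eqP.
by rewrite mulf_eq0 invr_eq0 expf_eq0 (negPf r0) andbF.
Qed.

End Laurent.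

(** * Degree bounds for the partition function in its first parameter *)

Section SixVertexLaurent.

Variables (F : fieldType) (q p : F).
Local Notation bulk_wt := (bulk_wt q).
Local Notation left_wt := (left_wt q p).
Local Notation right_wt := (right_wt q p).
Local Notation half_row := (half_row q p).
Local Notation triangle_sum := (triangle_sum q p).
Local Notation top_up_sum := (top_up_sum q p).

Lemma laurent_sigma m (f : F -> F) :
  laurent m f -> laurent m (fun x => (f x)^-1) -> laurent m (fun x => sigma (f x)).
Proof. exact: laurentB. Qed.

Lemma laurent_bulk_wt c t b h k : laurent 1 (fun x => bulk_wt (x * c) t b h k).
Proof.
have lZ d : laurent 1 (fun x => d * (x * c)).
  by apply: laurentZ; apply: laurentMr; apply: laurent_id.
have lV d : laurent 1 (fun x => d * (x * c)^-1).
  apply: laurentZ; apply: eq_laurent (laurentMr c^-1 (laurent_inv F)) => x.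
  by rewrite invfM.
case: t b h k => [] [] [] []; try exact: laurent_const.
all: apply: laurentMr; apply: laurent_sigma => //.
all: try by apply: eq_laurent (lV (q ^- 2)) => x; rewrite [RHS]invfM.
all: by apply: eq_laurent (lZ (q ^- 2)) => x; rewrite [RHS]invfM invrK.
Qed.

Lemma laurent_sqr : laurent 2 (fun x : F => x ^+ 2).
Proof. exact: (laurentM (laurent_id F) (laurent_id F)). Qed.

Lemma laurent_sqrV : laurent 2 (fun x : F => x^-1 ^+ 2).
Proof. exact: (laurentM (laurent_inv F) (laurent_inv F)). Qed.

Lemma laurent_sigmaZ m c (f : F -> F) :
  laurent m f -> laurent m (fun x => (f x)^-1) ->
  laurent m (fun x => sigma (c * f x)).
Proof.
move=> lf lV; apply: laurent_sigma; first exact: laurentZ.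
by apply: eq_laurent (laurentZ c^-1 lV) => x; rewrite invfM.
Qed.

Let id2 : laurent 2 (@id F) := laurent_widen (leqnSn 1) (laurent_id F).
Let inv2 : laurent 2 (@GRing.inv F) := laurent_widen (leqnSn 1) (laurent_inv F).

Let id2V : laurent 2 (fun x : F => x^-1^-1).
Proof. by apply: eq_laurent id2 => x; rewrite invrK. Qed.

Let sqr2 : laurent 2 (fun x : F => (x ^+ 2)^-1).
Proof. by apply: eq_laurent laurent_sqrV => x; rewrite exprVn. Qed.

Let sqrV2 : laurent 2 (fun x : F => (x^-1 ^+ 2)^-1).
Proof. by apply: eq_laurent laurent_sqr => x; rewrite exprVn invrK. Qed.

Lemma laurent_left_wt t h : laurent 2 (fun x => left_wt x t h).
Proof.
by case: t h => [] []; try exact: laurent_const; apply: laurentMr;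
  apply: laurent_sigmaZ => //; apply: laurent_sqr.
Qed.

Lemma laurent_right_wt t h : laurent 2 (fun x => right_wt x t h).
Proof.
by case: t h => [] []; try exact: laurent_const; apply: laurentMr;
  apply: laurent_sigmaZ => //; apply: laurent_sqrV.
Qed.

Lemma laurent_half_row h cs K ts :
  laurent (size cs + 2) (fun x => half_row x h cs K ts).
Proof.
elim: cs h K ts => [|c cs IH] h K [|t ts]; try exact: laurent_const.
  case: ts => [|? ?]; last exact: laurent_const.
  by apply: laurentMr; apply: laurent_right_wt.
do 2!apply: laurent_sum => ?.
exact: (laurentM (laurent_bulk_wt c t _ h _) (IH _ _ ts)).
Qed.

(** Only the outer row involves x: each of its [(size us).*2.+1] bulk vertices contributes 1 to the
    bound, and each of its two boundary vertices 2. *)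
Lemma laurent_top_up_sum us : laurent ((size us).*2 + 5) (fun x => top_up_sum (x :: us)).
Proof.
apply: laurent_sum => h.
have := laurentM (laurent_left_wt true h)
  (laurent_half_row h (us ++ p :: rev us) (triangle_sum us) (nseq (size us).+1.*2 true)).
by apply: laurent_widen; rewrite size_cat /= size_rev; move: (size us) => n; lia.
Qed.

End SixVertexLaurent.

Lemma uniq_map_inj (T1 T2 : eqType) (f : T1 -> T2) (s : seq T1) :
  uniq (map f s) -> {in s &, injective f}.
Proof.
elim: s => [|x s IH] //= /andP[fx us] y z; rewrite !inE.
move=> /predU1P[->|ys] /predU1P[->|zs] // e; last exact: IH e.
  by case/negP: fx; rewrite e map_f.
by case/negP: fx; rewrite -e map_f.
Qed.

(** * Generic parameters, the nodes, and the induction *)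

Section Interpolation.

Variables (F : fieldType) (q p : F).
Hypothesis q4E : q ^+ 4 = q ^+ 2 - 1.
Hypothesis two_neq0 : 2%:R != 0 :> F.
Hypothesis three_neq0 : 3%:R != 0 :> F.
Hypothesis p_neq0 : p != 0.
Local Notation top_up_sum := (top_up_sum q p).
Local Notation schur_form := (schur_form p).
Local Notation pfactor := (pfactor p).

Let q0 : q != 0 := sixth_q_neq0 q4E.

Lemma twelfth_q6 : q ^+ 6 = -1.
Proof. by ring: q4E. Qed.

Lemma twelfth_q12 : q ^+ 12 = 1.
Proof. by rewrite (exprM q 6 2) twelfth_q6 sqrrN expr1n. Qed.

(** The order of q divides 12 but neither 4 nor 6. *)
Lemma twelfth_primitive : 12.-primitive_root q.
Proof.
have [m prim_m m12] := prim_order_exists (isT : (0 < 12)%N) twelfth_q12.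
have q41 : q ^+ 4 != 1.
  apply: contraNneq three_neq0 => e; have q2 : q ^+ 2 = 2%:R.
    by apply/eqP; rewrite -subr_eq0 -[2%:R]/(1 + 1) opprD addrA -q4E e subrr.
  have -> : 3%:R = 2%:R * 2%:R - 1 :> F by ring.
  by rewrite -q2 -exprD e subrr.
have q61 : q ^+ 6 != 1.
  rewrite twelfth_q6; apply: contraNneq two_neq0 => e.
  by rewrite -[2%:R]/(1 + 1) -[X in X + _]e addNr.
have dvdm k : q ^+ k != 1 -> ~~ (m %| k)%N.
  by apply: contraNN => mk; rewrite -(prim_order_dvd prim_m) mk.
move: m12 (dvdm _ q41) (dvdm _ q61) (dvdn_leq (isT : (0 < 12)%N) m12) prim_m.
by case: m {dvdm} => [|[|[|[|[|[|[|[|[|[|[|[|[|m]]]]]]]]]]]]].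
Qed.

(** All nodes are q^k or q^k / u, whose 12th powers are 1 and u^-12. Conditions on 12th powers thus
    keep the nodes distinct, the arguments of the Schur function distinct at the nodes where it is
    evaluated, and the factors [sigma (q ^+ 4 * u / v)] cancelled in exchanges nonzero. *)
Definition generic (us : seq F) :=
  uniq (p ^+ 12 :: 1 :: [seq u ^+ 12 | u <- us] ++ [seq (u ^+ 12)^-1 | u <- us]).

Lemma generic_subseq us us' : subseq us us' -> generic us' -> generic us.
Proof.
move=> ss; apply: subseq_uniq; rewrite /= !eqxx.
by apply: cat_subseq; apply: map_subseq.
Qed.

Lemma generic_neq0 us : generic us -> 0 \notin us.
Proof.
move=> gen; apply/negP => us0; move: gen; rewrite /generic /= => /and3P[_ _].
rewrite cat_uniq => /and3P[_ /hasP[]]; exists (0 ^+ 12).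
  by apply/mapP; exists 0; rewrite // expr0n invr0.
by apply/mapP; exists 0.
Qed.

Lemma sixth_powers (us : seq F) :
  perm_eq [seq z ^+ 6 | z <- with_inverses (sqr_seq us)]
    ([seq u ^+ 12 | u <- us] ++ [seq (u ^+ 12)^-1 | u <- us]).
Proof.
rewrite (permPl (perm_map _ (perm_with_inverses _))) map_cat -!map_comp.
rewrite (eq_map (g := fun u : F => u ^+ 12)).
  rewrite (eq_map (f := _ \o _) (g := fun u : F => (u ^+ 12)^-1)) // => u /=.
  by rewrite exprVn -exprM.
by move=> u /=; rewrite -exprM.
Qed.

Lemma generic_uniq us : generic us ->
  uniq ([:: 1; -1] ++ with_inverses (sqr_seq us)).
Proof.
rewrite /generic 2![uniq (_ :: _)]/= => /and3P[_ x1 ux].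
have z6 z : z ^+ 6 = 1 -> z \notin with_inverses (sqr_seq us).
  move=> z61; apply: contra x1 => zus; rewrite -(perm_mem (sixth_powers us)).
  by have := map_f (fun z => z ^+ 6) zus; rewrite z61.
rewrite /= inE negb_or !z6 ?expr1n // ?andbT; last by ring.
rewrite (map_uniq (f := fun z => z ^+ 6)) ?(perm_uniq (sixth_powers us)) // andbT.
rewrite andbT; apply: contraNneq two_neq0 => e.
by rewrite -[2%:R]/(1 + 1) [X in X + _]e addNr.
Qed.

Lemma generic_uniq_base us r : generic us -> r ^+ 12 = 1 -> r ^+ 4 != 1 ->
  uniq (with_inverses (sqr_seq (r :: us))).
Proof.
move=> gen r12 r4; have := gen.
rewrite /generic 2![uniq (_ :: _)]/= => /and3P[_ x1 ux].
have z6 z : z ^+ 6 = 1 -> z \notin with_inverses (sqr_seq us).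
  move=> z61; apply: contra x1 => zus; rewrite -(perm_mem (sixth_powers us)).
  by have := map_f (fun z => z ^+ 6) zus; rewrite z61.
have r0 : r != 0 by move: (oner_neq0 F); rewrite -r12 expf_eq0.
have := generic_uniq gen; rewrite cat_uniq => /and3P[_ _ uW].
rewrite /= inE negb_or uW andbT !z6 ?andbT ?exprVn -?exprM ?r12 ?invr1 //.
apply: contraNneq r4 => e; have -> : r ^+ 4 = r ^+ 2 * r ^+ 2 by ring.
by rewrite [X in X * _]e mulVf ?expf_neq0.
Qed.

(** Since r^12 = u^-12, sixth powers separate r^2, r^-2, u^2, u^-2 from the other arguments. Among
    these four, coincidences are excluded by u^12 != u^-12 and by the condition on (r u)^2. *)
Lemma generic_uniq_pair u us r : generic (u :: us) -> (r * u) ^+ 12 = 1 ->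
  (r * u) ^+ 2 != 1 -> uniq (with_inverses (sqr_seq [:: r, u & us])).
Proof.
move=> gen ru12 ru2; have u0 := generic_neq0 gen.
have : (r * u) ^+ 12 != 0 by rewrite ru12 oner_neq0.
rewrite expf_eq0 mulf_eq0 negb_or => /andP[r0 u00].
have r12 : r ^+ 12 = (u ^+ 12)^-1.
  by apply: (mulIf (expf_neq0 12 u00)); rewrite -exprMn ru12 mulVf ?expf_neq0.
have := generic_uniq gen; rewrite cat_uniq => /and3P[_ _ uW].
have := gen; rewrite /generic /= => /and3P[_ _ /andP[]].
rewrite mem_cat inE negb_or => /andP[u1] /norP[uu u2].
rewrite cat_uniq /= => /and3P[us12 nhas /andP[u3 usV]].
have rW z : z ^+ 6 = u ^+ 12 \/ z ^+ 6 = (u ^+ 12)^-1 ->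
    z \notin with_inverses (sqr_seq us).
  move=> z6; apply/negP => zW.
  have := map_f (fun y => y ^+ 6) zW.
  rewrite (perm_mem (sixth_powers us)) mem_cat.
  move: nhas; rewrite negb_or => /andP[u4 _].
  by case: z6 => ->; rewrite ?(negPf u1) ?(negPf u2) ?(negPf u3) ?(negPf u4).
have r2 : r ^+ 2 != (u ^+ 2)^-1.
  apply: contraNneq ru2 => e.
  by rewrite exprMn e mulVf // expf_neq0.
have r3 : r ^+ 2 != u ^+ 2.
  apply: contraNneq uu => e.
  by rewrite -r12 -[12%N]/(2 * 6)%N !exprM e.
have r4 : r ^+ 2 != (r ^+ 2)^-1.
  apply: contraNneq uu => e.
  rewrite -{1}[u ^+ 12]invrK -r12 -[12%N]/(2 * 6)%N !exprM -exprVn -e.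
  by rewrite -!exprM.
have r5 : (r ^+ 2)^-1 != u ^+ 2.
  by apply: contraNneq r2 => <-; rewrite invrK.
have r6 : (r ^+ 2)^-1 != (u ^+ 2)^-1.
  by apply: contraNneq r3 => /invr_inj ->.
have r7 : r ^+ 2 \notin with_inverses (sqr_seq us).
  by apply: rW; right; rewrite -exprM.
have r8 : (r ^+ 2)^-1 \notin with_inverses (sqr_seq us).
  by apply: rW; left; rewrite exprVn -exprM r12 invrK.
move: uW => /=; rewrite !inE !negb_or => /and3P[/andP[-> ->] -> ->].
by rewrite r2 r3 r4 r5 r6 r7 r8.
Qed.

Let sq2 : sigma (q ^+ 2) != 0.
Proof. by rewrite sixth_sigma2 // sixth_s_neq0. Qed.

Let sq4 : sigma (q ^+ 4) != 0.
Proof. by rewrite sixth_sigma4 // sixth_s_neq0. Qed.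

(* The numbers k listed here are those with q ^+ (4 * k) = q ^+ 4 or q ^- 4,
   respectively q ^+ k = q ^+ 2 or q ^- 2 up to sign. *)
Definition nodes us : seq F :=
  [seq q ^+ k | k <- [:: 1; 2; 4; 5; 7; 8; 10; 11]%N]
  ++ [seq q ^+ k / u | u <- p :: us, k <- [:: 2; 4; 8; 10]%N].

Lemma size_nodes us : size (nodes us) = ((size us).*2.*2 + 12)%N.
Proof.
by rewrite size_cat size_allpairs /=; move: (size us) => n; clear; lia.
Qed.

Lemma twelfth_root_inj k l : (k < 12)%N -> (l < 12)%N -> q ^+ k = q ^+ l -> k = l.
Proof.
move=> k12 l12 /eqP; rewrite (eq_prim_root_expr twelfth_primitive).
by rewrite !modn_small // => /eqP.
Qed.

Lemma exp_ratio k u : (q ^+ k / u) ^+ 12 = (u ^+ 12)^-1.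
Proof.
by rewrite exprMn exprVn -exprM mulnC exprM twelfth_q12 expr1n mul1r.
Qed.

Lemma nodes_neq0 us : generic us -> 0 \notin nodes us.
Proof.
move=> gen; have us0 := generic_neq0 gen.
rewrite mem_cat negb_or; apply/andP; split.
  by apply/negP => /mapP[k _ /esym/eqP]; rewrite expf_eq0 (negPf q0) andbF.
apply/negP => /allpairsP[[u k] /= [uus _ /esym/eqP]].
rewrite mulf_eq0 expf_eq0 (negPf q0) andbF invr_eq0 => /eqP u0.
by move: uus; rewrite u0 inE eq_sym (negPf p_neq0) (negPf us0).
Qed.

Lemma uniq_nodes us : generic us -> uniq (nodes us).
Proof.
move=> gen; have us0 := generic_neq0 gen.
have [u12 n12] : uniq [seq u ^+ 12 | u <- p :: us]
    /\ forall u, u \in p :: us -> u ^+ 12 != 1.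
  move: gen; rewrite /generic /= inE mem_cat !negb_or => /and3P[].
  move=> /and3P[p1 pus _]; rewrite mem_cat negb_or => /andP[us1 _].
  rewrite cat_uniq => /and3P[uus _ _]; rewrite pus uus; split=> // u.
  rewrite inE => /predU1P[->|uus'] //.
  by apply: contraNneq us1 => <-; apply: map_f.
rewrite cat_uniq; apply/and3P; split.
- rewrite map_inj_in_uniq // => k l kK lK.
  have lt12 : {in [:: 1; 2; 4; 5; 7; 8; 10; 11]%N, forall k, k < 12}%N by apply/allP.
  by apply: twelfth_root_inj; apply: lt12.
- apply/hasPn => x xu; apply/mapP => -[l _ xE].
  case/allpairsP: xu => -[u k] /= [uus _ xE'].
  have := congr1 (fun z => z ^+ 12) xE; rewrite xE'.
  rewrite exp_ratio -exprM mulnC exprM twelfth_q12 expr1n => /(congr1 GRing.inv).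
  by rewrite invrK invr1 => /eqP; rewrite (negPf (n12 u uus)).
- apply: allpairs_uniq => //; first exact: map_uniq u12.
  move=> uk vl /allpairsP[[u' k'] [uus kK ->]] /allpairsP[[v' l'] [vus lK ->]] /= e.
  rewrite /= in uus kK vus lK.
  have uv : u' = v'.
    apply: (uniq_map_inj u12) => //; apply: invr_inj.
    by rewrite -(exp_ratio k') e exp_ratio.
  move: e; rewrite uv => e; congr ((_, _)).
  apply: twelfth_root_inj.
  - have lt12 : {in [:: 2; 4; 8; 10]%N, forall k, k < 12}%N by apply/allP.
    exact: lt12.
  - have lt12 : {in [:: 2; 4; 8; 10]%N, forall k, k < 12}%N by apply/allP.
    exact: lt12.
  apply: mulIf e; rewrite invr_eq0.
  by apply: contraNneq us0 => v0; move: vus; rewrite v0 inE eq_sym (negPf p_neq0).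
Qed.

(** If it vanished, q^4 u / v would have square 1, hence 12th power 1, in which q disappears. *)
Lemma sigma_ratio_neq0 u v : u != 0 -> v != 0 -> u ^+ 12 != v ^+ 12 ->
  sigma (q ^+ 4 * u / v) != 0.
Proof.
move=> u0 v0; apply: contraNneq => /eqP; rewrite subr_eq0 => /eqP e.
have z0 : q ^+ 4 * u / v != 0 by rewrite !mulf_neq0 ?invr_eq0 ?expf_neq0.
have z2 : (q ^+ 4 * u / v) ^+ 2 = 1 by rewrite expr2 {1}e mulVf.
have : (q ^+ 4 * u / v) ^+ 12 = 1 by rewrite (exprM _ 2 6) z2 expr1n.
rewrite exprMn exprMn (exprAC q) twelfth_q12 expr1n mul1r exprVn => e12.
by apply/eqP; apply: (mulIf (invr_neq0 (expf_neq0 12 v0))); rewrite e12 divff ?expf_neq0.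
Qed.

(** Where two arguments coincide, the ratio of alternants is a division by 0, so [schur_form] itself
    is not a Laurent polynomial in x. [g] is the Laurent polynomial equal to it elsewhere, and it
    retains the factor [pfactor x]. *)
Lemma schur_form_laurent us : generic us ->
  exists g, [/\ laurent ((size us).*2 + 2) g,
    forall x, x != 0 -> uniq (with_inverses (sqr_seq (x :: us))) ->
      g x = schur_form (x :: us)
    & forall x, pfactor x = 0 -> g x = 0].
Proof.
move=> gen; have us0 := generic_neq0 gen.
have sqr0 : 0 \notin sqr_seq us.
  by apply: contra us0 => /mapP[u uus /esym/eqP]; rewrite expf_eq0 => /eqP <-.
have [H [sH HE]] := stair_schur_laurent (generic_uniq gen) sqr0.
rewrite size_map in sH HE.
pose c := 3%:R ^- 'C((size us).+2, 2) * \prod_(u <- us) pfactor u.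
exists (fun x => c * ((x ^+ 2) ^- size us * H.[x ^+ 2]) * pfactor x); split.
- apply: laurentM; first apply: laurentZ.
    exists (H \Po 'X^2); split.
      apply: leq_trans (size_comp_poly_leq _ _) _; rewrite size_polyXn.
      by move: sH; move: (size H) (size us) => i j; clear; lia.
    by move=> x x0; rewrite horner_comp hornerXn -exprM mul2n.
  apply: laurentD; last by apply: laurentZ; apply: laurent_sqrV.
  apply: laurentD; last exact: laurent_const.
  by apply: laurentZ; apply: laurent_sqr.
- move=> x x0 ux; rewrite -HE //; last exact: expf_neq0.
  by rewrite /schur_form big_cons /c /=; ring.
- by move=> x ->; rewrite mulr0.
Qed.

Theorem top_up_sum_schur_form us : generic us -> top_up_sum us = schur_form us.
Proof.
(* Strong induction, because the nodes q^k / u with u in [us] remove two parameters at once. *)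
have [n] := ubnP (size us); elim: n us => // n IH [|v us] /=.
  rewrite /top_up_sum /schur_form /stair_schur /alternant /= !big_nil !det_mx00.
  by rewrite bin_small // expr0 !invr1 !mulr1.
rewrite ltnS => usn gen_v.
have gen : generic us by apply: generic_subseq gen_v; apply: subseq_cons.
have us0 := generic_neq0 gen.
have IHus := IH us usn gen.
have [g [lg gE g0]] := schur_form_laurent gen.
have v0 : v != 0.
  by have := generic_neq0 gen_v; rewrite inE negb_or eq_sym => /andP[].
rewrite -gE //; last first.
  by have := generic_uniq gen_v; rewrite cat_uniq => /and3P[].
(* The nodes depend on [us] alone; [v] is then one of the nonzero values of x at which the identity
   holds. *)
apply: (laurent_interpolation (f := fun x => top_up_sum (x :: us))
   (m := ((size us).*2 + 5)%N)   (rs := nodes us)) => //.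
- exact: laurent_top_up_sum.
- by apply: laurent_widen lg; rewrite leq_add2l.
- exact: uniq_nodes.
- by rewrite size_nodes; move: (size us) => k; clear; lia.
- exact: nodes_neq0.
move=> r rnodes; have r0 : r != 0.
  by apply: contraNneq (nodes_neq0 gen) => <-.
have all0 s : 0 \notin s -> all (predC1 0) s.
  by move=> s0; apply/allP => u us' /=; apply: contraNneq s0 => <-.
have r0us : all (predC1 0) (r :: us) by rewrite /= r0 all0.
move: rnodes; rewrite mem_cat => /orP[/mapP[k kK rE]|/allpairsP[[u k] /= [uus kK rE]]].
  (* Nodes that are powers of q: r^4 is q^4 or q^-4, and the first row freezes. *)
  have r4 : r ^+ 4 = q ^+ 2 - 1 \/ r ^+ 4 = - q ^+ 2.
    move: kK; rewrite rE !inE.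
    by repeat case/orP; move/eqP=> ->; (by left; ring: q4E) || (by right; ring: q4E).
  have r12 : r ^+ 12 = 1 by rewrite rE -exprM mulnC exprM twelfth_q12 expr1n.
  have r41 : r ^+ 4 != 1.
    rewrite rE -exprM -[1](expr0 q) (eq_prim_root_expr twelfth_primitive).
    by move: k kK {rE}; apply/allP.
  have uniq_r := generic_uniq_base gen r12 r41.
  rewrite gE //; case: r4 => r4.
    exact: top_up_sum_right_node.
  exact: top_up_sum_left_node.
move: uus; rewrite inE => /predU1P[up|uus].
  (* Nodes q^k / p: both sides vanish, the right one because (p r)^2 is a primitive cube root of
     unity. *)
  have pr : pfactor r = 0.
    rewrite /pfactor rE up; move: kK; rewrite !inE.
    by repeat case/orP; move/eqP=> ->; field: q4E; rewrite ?p_neq0 ?q0.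
  rewrite g0 // -[r :: us]/([::] ++ r :: us) top_up_sum_move_last //.
  - have e : exists2 e, e ^+ 2 = 1 & r * p = e * q ^+ 2 \/ r * p = e * q ^- 2.
      rewrite rE up divfK //; move: kK; rewrite !inE.
      repeat case/orP; move/eqP=> ->.
      + by exists 1; rewrite ?expr1n //; left; rewrite mul1r.
      + by exists (-1); rewrite ?sqrrN ?expr1n //; right; field: q4E.
      + by exists (-1); rewrite ?sqrrN ?expr1n //; left; ring: q4E.
      + by exists 1; rewrite ?expr1n //; right; field: q4E.
    by case: e => e e1 re; exact: top_up_sum_last_eq0 re.
  - move=> w wus; apply: sigma_ratio_neq0 => //.
      by apply: contraNneq us0 => <-.
    rewrite rE up exp_ratio; move: gen; rewrite /generic /=.
    rewrite inE !negb_or mem_cat negb_or => /andP[/and3P[_ _ pV] _].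
    apply: contraNneq pV => e; rewrite -[p ^+ 12]invrK -e.
    exact: (map_f (fun u => (u ^+ 12)^-1)).
(* Nodes q^k / u with u in [us]: u is moved next to r, and both are removed. *)
case/splitPr: uus gen us0 IHus usn r0us gE => us1 us2 gen us0 IHus usn r0us gE.
have uus : perm_eq (us1 ++ u :: us2) (u :: us1 ++ us2).
  by apply/seq.permP => P; rewrite /= !count_cat /= addnCA.
have gen_u : generic (u :: us1 ++ us2).
  move: gen; rewrite /generic; congr is_true; apply: perm_uniq.
  rewrite !perm_cons; apply: perm_cat; exact: perm_map uus.
have u0 : u != 0.
  by apply: contraNneq us0 => <-; rewrite mem_cat inE eqxx orbT.
have ru : r * u = q ^+ k by rewrite rE divfK.
have uniq_ru : uniq (with_inverses (sqr_seq [:: r, u & us1 ++ us2])).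
  apply: generic_uniq_pair => //; rewrite ru -exprM.
    by rewrite mulnC exprM twelfth_q12 expr1n.
  rewrite -(expr0 q) (eq_prim_root_expr twelfth_primitive).
  by move: k kK {rE ru}; apply/allP.
have perm_ru : perm_eq (r :: us1 ++ u :: us2) [:: r, u & us1 ++ us2].
  by rewrite perm_cons.
have uniq_r : uniq (with_inverses (sqr_seq (r :: us1 ++ u :: us2))).
  rewrite (perm_uniq (s2 := with_inverses (sqr_seq [:: r, u & us1 ++ us2]))) //.
  by apply: perm_flatten; do 2!apply: perm_map.
rewrite gE // (schur_form_perm p perm_ru).
have -> : top_up_sum (r :: us1 ++ u :: us2) = top_up_sum [:: r, u & us1 ++ us2].
  rewrite -[r :: _]/([:: r] ++ us1 ++ u :: us2) top_up_sum_move_first // => w wus.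
  apply: sigma_ratio_neq0 => //.
    by apply: contraNneq us0 => <-; rewrite mem_cat wus.
  move: gen_u; rewrite /generic /= => /and3P[_ _ /andP[+ _]].
  rewrite map_cat !mem_cat; apply: contraNneq => ->.
  by rewrite (map_f (fun z => z ^+ 12) wus).
have gen12 : generic (us1 ++ us2).
  by apply: generic_subseq gen_u; apply: subseq_cons.
have IH12 : top_up_sum (us1 ++ us2) = schur_form (us1 ++ us2).
  by apply: IH => //; move: usn; rewrite !size_cat /= addnS; apply: ltnW.
have us120 := generic_neq0 gen12.
have rE' : r = q ^+ k / u by [].
move: kK; rewrite !inE => kK.
have : exists2 e, e ^+ 2 = 1 & r = e / (q ^+ 2 * u) \/ r = e * q ^+ 2 / u.
  rewrite rE; move: kK; repeat case/orP; move/eqP=> ->.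
  + by exists 1; rewrite ?expr1n //; right; rewrite mul1r.
  + by exists (-1); rewrite ?sqrrN ?expr1n //; left; field: q4E; rewrite u0 q0.
  + by exists (-1); rewrite ?sqrrN ?expr1n //; right; field: q4E; rewrite u0.
  + by exists 1; rewrite ?expr1n //; left; field: q4E; rewrite u0 q0.
case=> e e1 [] {}rE.
  exact: (top_up_sum_left_node2 _ _ _ e1 rE).
exact: (top_up_sum_right_node2 _ _ _ e1 rE).
Qed.

End Interpolation.

(** * Orientations as independent choices for the edges *)

Section ArcSums.

Variables (V : finType) (R : nmodType).
Implicit Types (a : V * V) (s : seq (V * V)) (O : {set V * V}).

Definition flip a := (a.2, a.1).

Lemma flipK : involutive flip. Proof. by case. Qed.

Fixpoint arc_sum s (f : {set V * V} -> R) O : R :=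
  if s is a :: s' then arc_sum s' f (a |: O) + arc_sum s' f (flip a |: O)
  else f O.

(** The orientations of the edges listed in [s], given by one arc each, together with the prescribed
    arcs [O0]. *)
Definition orients s O0 O : bool :=
  [&& O0 \subset O, all (fun a => (a \in O) (+) (flip a \in O)) s
    & [forall a, (a \in O) ==> [|| a \in O0, a \in s | flip a \in s]]].

(** Choosing a direction for the first edge adds that arc to the prescribed ones; disjointness keeps
    the choices independent. *)
Lemma sum_orients s (f : {set V * V} -> R) O0 :
  uniq (s ++ map flip s) -> (forall a, a \in s ++ map flip s -> a \notin O0) ->
  \sum_(O | orients s O0 O) f O = arc_sum s f O0.
Proof.
have mem_flip a s' : (a \in map flip s') = (flip a \in s').
  by rewrite -{1}[a]flipK mem_map //; apply: inv_inj flipK.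
elim: s O0 => [|a s IH] O0 us O0s /=.
  rewrite (big_pred1 O0) // => O; rewrite /orients /= eqEsubset andbC.
  congr (_ && _); apply/forallP/subsetP => [sub b bO|sub b].
    by have := sub b; rewrite bO orbF.
  by apply/implyP => /sub ->.
have perm_s : perm_eq ((a :: s) ++ map flip (a :: s))
    [:: a, flip a & s ++ map flip s].
  by rewrite /= perm_cons -cat_cons -[_ :: map _ _]cat1s perm_catCA.
have := us; rewrite (perm_uniq perm_s) /= inE negb_or.
move=> /and3P[/andP[aa' as_] a's us'].
have sub_s b : b \in s ++ map flip s -> b \in (a :: s) ++ map flip (a :: s).
  by rewrite (perm_mem perm_s) !inE => ->; rewrite !orbT.
have aO0 : a \notin O0 by apply: O0s; rewrite (perm_mem perm_s) inE eqxx.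
have a'O0 : flip a \notin O0.
  by apply: O0s; rewrite (perm_mem perm_s) !inE eqxx orbT.
move: as_ a's; rewrite !mem_cat !mem_flip flipK !negb_or.
move=> /andP[as_ a's] _.
rewrite -!IH //; first last.
- move=> b bs; rewrite in_setU1 negb_or O0s ?sub_s // andbT.
  by apply: contraTneq bs => ->; rewrite mem_cat mem_flip negb_or as_ a's.
- move=> b bs; rewrite in_setU1 negb_or O0s ?sub_s // andbT.
  by apply: contraTneq bs => ->; rewrite mem_cat mem_flip flipK negb_or as_ a's.
rewrite (bigID (fun O => a \in O)) /=; congr (_ + _); apply: eq_bigl => O.
  rewrite /orients subUset sub1set /=; apply/idP/idP.
    move=> /andP[/and3P[-> /andP[aO ->] /forallP sub] aO1].
    rewrite aO1 /=; apply/forallP => b; apply/implyP => bO.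
    have := sub b; rewrite bO !inE /= => /or3P[->||] //.
    - by rewrite orbT.
    - by case/predU1P=> [->|->]; rewrite ?eqxx ?orbT.
    - case/predU1P=> [ba|->]; last by rewrite !orbT.
      by move: aO; rewrite aO1 -ba flipK bO.
  move=> /and3P[/andP[aO ->] sO /forallP sub].
  have a'O : flip a \notin O.
    apply/negP => a'O; have := sub (flip a); rewrite a'O in_setU1 flipK.
    by rewrite (negPf a'O0) (negPf as_) (negPf a's) !orbF eq_sym (negPf aa').
  rewrite aO (negPf a'O) sO /= andbT; apply/forallP => b; apply/implyP => bO.
  have := sub b; rewrite bO !inE /= => /or3P[/predU1P[->|->]|->|->];
    by rewrite ?eqxx ?orbT.
rewrite /orients subUset sub1set /=; apply/idP/idP.
  move=> /andP[/and3P[-> /andP[aO ->] /forallP sub] aO1].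
  have a'O : flip a \in O by move: aO; rewrite (negPf aO1).
  rewrite a'O /=; apply/forallP => b; apply/implyP => bO.
  have := sub b; rewrite bO !inE /= => /or3P[->||] //.
  - by rewrite orbT.
  - case/predU1P=> [ba|->]; last by rewrite !orbT.
    by move: aO1; rewrite -ba bO.
  - case/predU1P=> [<-|->]; last by rewrite !orbT.
    by rewrite flipK eqxx.
move=> /and3P[/andP[a'O ->] sO /forallP sub].
have aO : a \notin O.
  apply/negP => aO; have := sub a; rewrite aO in_setU1.
  by rewrite (negPf aO0) (negPf as_) (negPf a's) !orbF (negPf aa').
rewrite a'O (negPf aO) sO /= andbT; apply/forallP => b; apply/implyP => bO.
have := sub b; rewrite bO !inE /= => /or3P[/predU1P[->|->]|->|->];
  by rewrite ?flipK ?eqxx ?orbT.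
Qed.

End ArcSums.

Section Edges.

Variable n : nat.

(* (true, i, j) is the edge from (i, j) up to (i - 1, j), (false, i, j) the edge
   from (i, j) right to (i, j + 1). *)
Definition edge : Type := (bool * nat * nat)%type.

Definition is_edge (e : edge) : bool :=
  let: (k, i, j) := e in
  if k then ((1 <= i <= n.+1) && (i <= j <= n.*2.+2 - i))%N
  else ((1 <= i <= n) && (i <= j < n.*2.+2 - i))%N.

Definition pt (i j : nat) : grid n := (inord i, inord j).

Definition arc (e : edge) : grid n * grid n :=
  let: (k, i, j) := e in
  if k then (pt i j, pt i.-1 j) else (pt i j, pt i j.+1).

Lemma coord_pt i j : (i < n.+2)%N -> (j < n.*2.+2)%N -> coord (pt i j) = (i, j).
Proof. by move=> ni nj; rewrite /coord /= !inordK. Qed.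

Lemma pt_coord (x : grid n) : pt (coord x).1 (coord x).2 = x.
Proof. by case: x => i j; rewrite /pt !inord_val. Qed.

Lemma coord_arc e : is_edge e ->
  (coord (arc e).1, coord (arc e).2) =
  let: (k, i, j) := e in
  if k then ((i, j), (i.-1, j)) else ((i, j), (i, j.+1)).
Proof. by case: e => -[[] i] j /= ij; rewrite !coord_pt //; lia. Qed.

Lemma adjacent_arc e : is_edge e -> adjacent n (coord (arc e).1) (coord (arc e).2).
Proof.
move=> ee; rewrite [coord _](congr1 fst (coord_arc ee)) /=.
rewrite [coord _.2](congr1 snd (coord_arc ee)) /=.
by case: e ee => -[[] i] j /=; rewrite /adjacent /is_vertex /=; lia.
Qed.

Lemma adjacent_sym x y : adjacent n x y = adjacent n y x.
Proof.
rewrite /adjacent andbCA; congr [&& _, _ & _].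
by case: x y => i j [i' j'] /=; apply/idP/idP; lia.
Qed.

Lemma arc_of_adjacent (x y : grid n) : adjacent n (coord x) (coord y) ->
  exists2 e, is_edge e & (x, y) = arc e \/ (x, y) = flip (arc e).
Proof.
rewrite -{2 3}[x]pt_coord -{2 3}[y]pt_coord.
case: (coord x) (coord y) => i j [i' j']; rewrite /adjacent /= => /and3P[xv yv].
case/orP=> [/andP[/eqP jE ii]|/and3P[/eqP iE i0 jj]].
  move: yv; rewrite -jE => yv; case/orP: ii => /eqP ii.
    exists (true, i, j); last by left; rewrite /= ii.
    by move: xv yv; rewrite /is_edge /is_vertex /=; lia.
  exists (true, i', j); last by right; rewrite /flip /= ii.
  by move: xv yv; rewrite /is_edge /is_vertex /=; lia.
move: yv; rewrite -iE => yv; case/orP: jj => /eqP jj.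
  exists (false, i, j'); last by right; rewrite /flip /= jj.
  by move: xv yv; rewrite /is_edge /is_vertex /=; lia.
exists (false, i, j); last by left; rewrite /= jj.
by move: xv yv; rewrite /is_edge /is_vertex /=; lia.
Qed.

Lemma arc_inj : {in is_edge &, injective arc}.
Proof.
move=> e e' ee ee' eE; have := coord_arc ee; rewrite eE (coord_arc ee').
move: ee ee'; rewrite !unfold_in; case: e e' {eE} => [[[] i] j] [[[] i'] j'] /=.
- by move=> ? ? [-> ->].
- by move=> ? ? [? ? ? ?]; exfalso; lia.
- by move=> ? ? [? ? ? ?]; exfalso; lia.
- by move=> ? ? [-> ->].
Qed.

Lemma arc_flip e e' : is_edge e -> is_edge e' -> arc e <> flip (arc e').
Proof.
move=> ee ee' eE; have := coord_arc ee; have := coord_arc ee'.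
rewrite eE /=; case: (coord _) (coord _) => [a b] [c d].
move: ee ee'; case: e e' {eE} => [[[] i] j] [[[] i'] j'] /=;
  by move=> ? ? [? ? ? ?] [? ? ? ?]; lia.
Qed.

Definition bits (O : {set grid n * grid n}) (e : edge) : bool :=
  is_edge e && (arc e \in O).

Definition set_bit (b : edge -> bool) (e : edge) (v : bool) : edge -> bool :=
  fun e' => if e' == e then v else b e'.

Variable R : nmodType.

Fixpoint edge_sum (s : seq edge) (g : (edge -> bool) -> R) b : R :=
  if s is e :: s' then
    \sum_(v : bool) edge_sum s' g (set_bit b e v)
  else g b.

(** Assignments of bits are functions and can be compared only pointwise, so the summand has to
    respect [=1]. *)
Lemma eq_edge_sum s g b b' : (forall b b', b =1 b' -> g b = g b') -> b =1 b' ->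
  edge_sum s g b = edge_sum s g b'.
Proof.
move=> gext; elim: s b b' => [|e s IH] b b' bb'; first exact: gext.
apply: eq_bigr => v _; apply: IH => e'; rewrite /set_bit.
by case: eqP.
Qed.

Lemma arc_sum_edges s (g : (edge -> bool) -> R) (O : {set grid n * grid n}) :
  (forall b b', b =1 b' -> g b = g b') ->
  uniq s -> all is_edge s -> (forall e, e \in s -> arc e \notin O) ->
  arc_sum (map arc s) (fun O => g (bits O)) O = edge_sum s g (bits O).
Proof.
move=> gext; elim: s O => [|e s IH] O //= /andP[es us] /andP[ee ees] sO.
rewrite big_bool; congr (_ + _).
  rewrite IH //; first apply: eq_edge_sum => // e'.
    rewrite /bits /set_bit in_setU1; case: (e' =P e) => [->|e'e].
      by rewrite ee eqxx.
    case ee': (is_edge e') => //=.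
    by case: eqP => // /arc_inj; rewrite !unfold_in => /(_ ee' ee)/e'e.
  move=> e' e's; rewrite in_setU1 negb_or sO ?inE ?e's ?orbT // andbT.
  apply: contraNneq es => /arc_inj <- //; rewrite unfold_in //.
  exact: (allP ees).
rewrite IH //; first apply: eq_edge_sum => // e'.
  rewrite /bits /set_bit in_setU1; case ee': (is_edge e') => /=; last first.
    by case: eqP ee' => // ->; rewrite ee.
  case: eqP => [/arc_flip|_] /=; first by case.
  by case: eqP => // ->; apply/negbTE/sO; rewrite mem_head.
move=> e' e's; rewrite in_setU1 negb_or sO ?inE ?e's ?orbT // andbT.
by apply/eqP/arc_flip => //; apply: (allP ees).
Qed.

End Edges.

Section Configurations.

Variable n : nat.
Local Notation is_edge := (is_edge n).
Local Notation arc := (@arc n).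
Local Notation pt := (pt n).
Implicit Type O : {set grid n * grid n}.

(** The order is that of the sums in [half_row]: at each vertex the edge to its right, then the edge
    below it. *)
Definition col_edges k (js : seq nat) : seq edge :=
  flatten [seq [:: (false, k, j); (true, k.+1, j)] | j <- js].

Definition row_edges k : seq edge :=
  (false, k, k) :: col_edges k (iota k.+1 (n.*2.+1 - k.*2)).

(** The vertical edges above row [k] are left out: they are the boundary data of the sum over the
    rows from [k] on. *)
Definition edges_from k : seq edge :=
  flatten [seq row_edges i | i <- iota k (n.+1 - k)].

Definition top_arcs : {set grid n * grid n} :=
  [set a in [seq arc (true, 1%N, j) | j <- iota 1 n.*2.+1]].

Lemma mem_col_edges k js (e : edge) :
  (e \in col_edges k js)
  = (e.2 \in js) && ((e.1 == (false, k)) || (e.1 == (true, k.+1))).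
Proof.
case: e => -[b i] j'; elim: js => [|j js IH] //.
rewrite /= !inE IH ![(_, j') == _]xpair_eqE /=.
by do 4?case: (_ == _); rewrite ?andbF ?orbF ?orbT //= andbT.
Qed.

Lemma mem_row_edges k (e : edge) : (1 <= k <= n)%N ->
  (e \in row_edges k) = is_edge e && (e.1 \in [:: (false, k); (true, k.+1)]).
Proof.
move=> kn; rewrite inE mem_col_edges mem_iota; case: e => -[b i] j /=.
rewrite !inE !xpair_eqE; case: b => /=; apply/idP/idP; lia.
Qed.

Lemma mem_edges_from k (e : edge) : (0 < k)%N ->
  (e \in edges_from k) = is_edge e && (k + e.1.1 <= e.1.2)%N.
Proof.
move=> k0; apply/flatten_mapP/idP => [[r]|].
  rewrite mem_iota => ik; rewrite mem_row_edges; last lia.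
  by case: e => -[b i'] j /andP[->]; rewrite !inE => /orP[] /eqP[-> ->] /=; lia.
case: e => -[b i] j /andP[ee ki].
have ibn : (1 <= i - b <= n)%N by move: ee ki; case: b => /=; lia.
exists (i - b)%N; first by move: ki => /=; rewrite mem_iota; lia.
rewrite mem_row_edges // ee !inE !xpair_eqE.
by move: ki ibn; case: b {ee} => /=; lia.
Qed.

Lemma edges_fromS k : (k <= n)%N ->
  edges_from k = row_edges k ++ edges_from k.+1.
Proof. by move=> kn; rewrite /edges_from subSn. Qed.

Lemma uniq_col_edges k js : uniq js -> uniq (col_edges k js).
Proof.
elim: js => //= j js IH /andP[jjs ujs].
by rewrite IH // !inE !mem_col_edges /= (negPf jjs) !xpair_eqE.
Qed.

Lemma uniq_edges_from k : (0 < k)%N -> uniq (edges_from k).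
Proof.
have [m] := ubnP (n.+1 - k); elim: m k => // m IH k km k0.
have [kn|kn] := leqP k n; last first.
  by rewrite /edges_from (_ : n.+1 - k = 0)%N //; lia.
rewrite edges_fromS // cat_uniq IH ?andbT //; last lia.
apply/andP; split.
  rewrite /= uniq_col_edges ?iota_uniq // andbT mem_col_edges mem_iota /=.
  by rewrite ltnn.
apply/hasPn => e; rewrite mem_edges_from // => /andP[ee ke].
apply/negP; rewrite mem_row_edges ?k0 // ee !inE => /orP[] /eqP eE;
  by move: ke; rewrite eE /=; lia.
Qed.

Definition tops_up O : bool :=
  [forall x : grid n, forall y : grid n,
     [&& adjacent n (coord x) (coord y), (coord x).1 == 1%N & (coord y).1 == 0%N]
     ==> ((x, y) \in O)].

Lemma adjacent_inner_or_top (x y : grid n) : adjacent n (coord x) (coord y) ->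
  exists2 e, (e \in edges_from 1) || (e.1 == (true, 1%N)) && is_edge e
    & (x, y) = arc e \/ (x, y) = flip (arc e).
Proof.
move=> /arc_of_adjacent[e ee eE]; exists e => //.
rewrite mem_edges_from // ee /= andbT; case: e ee {eE} => -[b i] j /=.
by rewrite xpair_eqE; case: b => /=; lia.
Qed.

Lemma mem_top_arcs (e : edge) : e.1 = (true, 1%N) -> is_edge e ->
  arc e \in top_arcs.
Proof.
case: e => -[b i] j /= [-> ->] ee; rewrite inE; apply/mapP; exists j => //.
by rewrite mem_iota; move: ee => /=; lia.
Qed.

Lemma top_arcsP a : a \in top_arcs ->
  exists2 e : edge, (e.1 = (true, 1%N)) /\ is_edge e & a = arc e.
Proof.
rewrite inE => /mapP[j]; rewrite mem_iota => jn ->.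
by exists (true, 1%N, j) => //=; split=> //; lia.
Qed.

Lemma orientation_flip O e : is_orientation O -> is_edge e ->
  (flip (arc e) \in O) = (arc e \notin O).
Proof.
move=> /forallP/(_ (arc e).1)/forallP/(_ (arc e).2) + ee.
rewrite adjacent_arc // -surjective_pairing /flip.
by case: (_ \in O) (_ \in O) => [] [].
Qed.

Lemma orients_edges O :
  orients (map arc (edges_from 1)) top_arcs O = is_orientation O && tops_up O.
Proof.
have inner e : e \in edges_from 1 -> is_edge e /\ e.1 != (true, 1%N).
  rewrite mem_edges_from // => /andP[-> e1]; split=> //.
  by apply: contraTneq e1 => ->.
apply/idP/idP.
  move=> /and3P[/subsetP top /allP inn /forallP sub].
  apply/andP; split; apply/forallP => x; apply/forallP => y.
    case: ifP => [/adjacent_inner_or_top[e eE xyE]|nadj].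
      suff xor : (arc e \in O) (+) (flip (arc e) \in O).
        have -> : (y, x) = flip (x, y) by [].
        by case: xyE => ->; rewrite ?flipK // addbC.
      case/orP: eE => [es|/andP[/eqP e1 ee]]; first exact/inn/map_f.
      rewrite top ?mem_top_arcs //=; apply/negP => fO.
      have := sub (flip (arc e)); rewrite fO flipK /= => /or3P[].
      - by case/top_arcsP=> e' [_ ee'] /esym; apply: arc_flip.
      - by case/mapP=> e' /inner[ee' _] /esym; apply: arc_flip.
      - case/mapP=> e' /inner[ee' e'1] /arc_inj eE.
        by move: e'1; rewrite -eE ?e1 ?eqxx.
    apply/negP => xyO; have := sub (x, y); rewrite xyO /= => /or3P[].
    - case/top_arcsP=> e [_ ee] eE; have := adjacent_arc ee.
      by rewrite -eE nadj.
    - case/mapP=> e /inner[ee _] eE; have := adjacent_arc ee.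
      by rewrite -eE nadj.
    - case/mapP=> e /inner[ee _] eE; have := adjacent_arc ee.
      by rewrite -eE adjacent_sym nadj.
  apply/implyP => /and3P[/arc_of_adjacent[e ee eE] x1 y0].
  have := congr1 fst (coord_arc ee); have := congr1 snd (coord_arc ee).
  case: eE => eE; rewrite ?eE.
    rewrite -eE; cbn [fst snd] => cy cx; rewrite eE; apply/top; apply: mem_top_arcs => //.
    move: x1 y0; rewrite cx cy; case: e ee {eE cx cy} => -[[] i] j _ /=.
      by move=> /eqP ->.
    by move=> /eqP ->.
  have -> : arc e = (y, x) by rewrite -[arc e]flipK -eE.
  cbn [fst snd] => cx cy; move: x1 y0; rewrite cx cy.
  by case: e ee {eE cx cy} => -[[] i] j /=; lia.
move=> /andP[ori /forallP tops]; have flipO e := @orientation_flip O e ori.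
have topO e : e.1 = (true, 1%N) -> is_edge e -> arc e \in O.
  move=> e1 ee; have /forallP/(_ (arc e).2)/implyP := tops (arc e).1.
  rewrite -surjective_pairing; apply; rewrite adjacent_arc // andTb.
  rewrite [coord (arc e).1](congr1 fst (coord_arc ee)).
  rewrite [coord (arc e).2](congr1 snd (coord_arc ee)).
  by case: e e1 ee => -[b i] j /= [-> ->].
apply/and3P; split.
- by apply/subsetP => a /top_arcsP[e [e1 ee] ->]; apply: topO.
- by apply/allP => _ /mapP[e /inner[ee _] ->]; rewrite flipO //; case: (_ \in O).
apply/forallP => -[x y]; apply/implyP => xyO.
have xy_adj : adjacent n (coord x) (coord y).
  by have /forallP/(_ x)/forallP/(_ y) := ori; case: ifP => //; rewrite xyO.
have [e] := adjacent_inner_or_top xy_adj.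
case/orP=> [es|/andP[/eqP e1 ee]] [] eE; rewrite eE.
- by rewrite map_f ?orbT.
- by rewrite flipK map_f ?orbT.
- by rewrite mem_top_arcs.
- by move: xyO; rewrite eE flipO ?topO.
Qed.

End Configurations.

(** * The partition function as a sum over bits of edges *)

Section Weights.

Variable n : nat.
Local Notation is_edge := (is_edge n).
Local Notation arc := (@arc n).
Local Notation pt := (pt n).
Implicit Type O : {set grid n * grid n}.

Definition neighbours (i j : nat) : seq (grid n) :=
  [:: pt i.-1 j; pt i.+1 j; pt i j.-1; pt i j.+1].

Lemma is_bulk_pt (x : grid n) i j : coord x = (i, j) -> is_bulk n (i, j) ->
  [/\ x = pt i j, uniq (neighbours i j)
    & forall y, adjacent n (i, j) (coord y) = (y \in neighbours i j)].
Proof.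
move=> xE bx; have pt_eq a b (y : grid n) : (a < n.+2)%N -> (b < n.*2.+2)%N ->
    (y == pt a b) = (coord y == (a, b)).
  move=> an bn; apply/eqP/eqP => [->|yE]; first exact: coord_pt.
  by rewrite -[y]pt_coord yE.
move: bx => /= bx; have [i1 j1] : (0 < i <= n)%N /\ (i < j < n.*2.+2 - i)%N by lia.
split.
- by rewrite -[x]pt_coord xE.
- rewrite /neighbours /= !inE !pt_eq ?coord_pt ?xpair_eqE; lia.
move=> y; rewrite !inE !pt_eq; try lia.
rewrite /adjacent /is_vertex; case: (coord y) => a b; rewrite /= !xpair_eqE.
by apply/idP/idP; lia.
Qed.

Lemma bulk_degrees O (x : grid n) i j : is_orientation O ->
  coord x = (i, j) -> is_bulk n (i, j) ->
  let out := [seq (x, y) \in O | y <- neighbours i j] in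
  #|[set y | (x, y) \in O]| = count id out
  /\ #|[set y | (y, x) \in O]| = count negb out.
Proof.
move=> ori xE bx out; have [xpt uN adjN] := is_bulk_pt xE bx.
have O_adj y z : if adjacent n (coord y) (coord z)
    then ((y, z) \in O) (+) ((z, y) \in O) else (y, z) \notin O.
  by have /forallP/(_ y)/forallP/(_ z) := ori.
have flipO y : y \in neighbours i j -> ((y, x) \in O) = ((x, y) \notin O).
  rewrite -adjN -xE => xy; have := O_adj x y; rewrite xy.
  by case: (_ \in O) (_ \in O) => [] [].
split.
  rewrite /out count_map -size_filter -(card_uniqP (filter_uniq _ uN)).
  apply: eq_card => y; rewrite inE mem_filter /=.
  case xyO: (_ \in O) => //=; rewrite -adjN -xE.
  by have := O_adj x y; rewrite xyO; case: ifP.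
rewrite /out count_map -size_filter -(card_uniqP (filter_uniq _ uN)).
apply: eq_card => y; rewrite inE mem_filter /=.
case yN: (y \in neighbours i j); first by rewrite flipO // andbT.
rewrite andbF; have := O_adj y x; rewrite adjacent_sym xE adjN yN.
by move/negbTE.
Qed.

Variables (F : fieldType) (q p : F) (u : 'I_n -> F) (v : F).

Lemma bulk_weight_neq0 (z : F) up down left right :
  bulk_weight q z up down left right != 0 ->
  count id [:: up; down; left; right] = 2%N
  /\ count negb [:: up; down; left; right] = 2%N.
Proof. by case: up; case: down; case: left; case: right; rewrite /= ?eqxx. Qed.

(** [bulk_weight] is 0 at a bulk vertex violating the degree condition, so this condition may be
    dropped. What remains is an independent choice for each edge below the top ones. *)
Lemma Z_AST_orients : Z_AST q p u v =
  \sum_(O | orients (map arc (edges_from n 1)) (top_arcs n) O)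
    \prod_(x : grid n | is_vertex n (coord x)) vertex_weight q p u v O (coord x).
Proof.
rewrite [RHS](bigID (@is_configuration n)) /= [X in _ + X]big1 ?addr0.
  apply: eq_bigl => O; rewrite orients_edges /is_configuration /tops_up.
  by apply/idP/andP => [cO|[]//]; split=> //; case/and3P: cO => -> _ ->.
move=> O; rewrite orients_edges => /andP[/andP[ori tops]].
rewrite /tops_up in tops; rewrite /is_configuration ori tops andTb andbT.
rewrite negb_forall => /existsP[x]; rewrite negb_imply => /andP[bx degx].
have vx : is_vertex n (coord x).
  by move: bx; case: (coord x) => i j; rewrite /is_bulk /is_vertex; lia.
rewrite (bigD1 x) //; apply/eqP; rewrite mulf_eq0; apply/orP; left.
change (vertex_weight q p u v O (coord x) == 0).
case xE: (coord x) bx => [i j] bx; rewrite /vertex_weight ifT //.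
apply: contraNT degx => /bulk_weight_neq0.
have [-> ->] := bulk_degrees ori xE bx; have [xpt _ _] := is_bulk_pt xE bx.
by rewrite /directed -/(pt i j) -xpt => -[/eqP -> /eqP ->].
Qed.

Definition bit_weight (b : edge -> bool) (i j : nat) : F :=
  if is_bulk n (i, j) then
    bulk_weight q (param u v i * param u v (minn j (2 * n + 2 - j)))
      (b (true, i, j)) (~~ b (true, i.+1, j))
      (~~ b (false, i, j.-1)) (b (false, i, j))
  else if is_left n (i, j) then
    left_weight q p (param u v i) (b (true, i, j)) (b (false, i, j))
  else if is_right n (i, j) then
    right_weight q p (param u v i) (b (true, i, j)) (~~ b (false, i, j.-1))
  else 1.

Lemma vertex_weight_bits O i j : is_orientation O ->
  vertex_weight q p u v O (i, j) = bit_weight (bits O) i j.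
Proof.
move=> ori; have flipO e := @orientation_flip n O e ori.
have eU : is_edge (true, i, j) ->
    directed O (i, j) (i.-1, j) = bits O (true, i, j) by rewrite /bits => ->.
have eD : is_edge (true, i.+1, j) ->
    directed O (i, j) (i.+1, j) = ~~ bits O (true, i.+1, j).
  by move=> ee; rewrite /bits ee -flipO.
have eR : is_edge (false, i, j) ->
    directed O (i, j) (i, j.+1) = bits O (false, i, j) by rewrite /bits => ->.
have eL : (0 < j)%N -> is_edge (false, i, j.-1) ->
    directed O (i, j) (i, j.-1) = ~~ bits O (false, i, j.-1).
  by move=> j0 ee; rewrite /bits ee -flipO // /arc prednK.
rewrite /vertex_weight /bit_weight.
case: ifP => [ij|_].
  have [e1 e2 e3 [e4 j0]] : [/\ is_edge (true, i, j), is_edge (true, i.+1, j),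
      is_edge (false, i, j) & is_edge (false, i, j.-1) /\ (0 < j)%N].
    by move: ij => /=; clear; repeat split; lia.
  by rewrite eU // eD // eR // eL.
case: ifP => [ij|_].
  have [e1 e2] : is_edge (true, i, j) /\ is_edge (false, i, j).
    by move: ij => /=; clear; split; lia.
  by rewrite eU // eR.
case: ifP => [ij|_] //.
have [e1 e2 j0] : [/\ is_edge (true, i, j), is_edge (false, i, j.-1) & (0 < j)%N].
  by move: ij => /=; clear; split; lia.
by rewrite eU // eL.
Qed.

Definition all_bits_weight (b : edge -> bool) : F :=
  \prod_(i <- iota 1 n) \prod_(j <- iota i (n.*2.+3 - i.*2)) bit_weight b i j.

Lemma prod_bit_weight b :
  \prod_(x : grid n | is_vertex n (coord x)) bit_weight b (coord x).1 (coord x).2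
  = all_bits_weight b.
Proof.
have w1 i j : ~~ ((0 < i <= n) && (i <= j <= n.*2.+2 - i))%N -> bit_weight b i j = 1.
  move=> ij; rewrite /bit_weight; do 3?[rewrite ifF]; rewrite //=;
    by apply/negbTE; move: ij; clear; lia.
transitivity (\prod_(x : grid n) bit_weight b x.1 x.2).
  rewrite big_mkcond; apply: eq_bigr => -[i j] _ /=.
  case: ifP => // nv; rewrite w1 //; move: nv; rewrite /is_vertex /=.
  by move: (nat_of_ord i) (nat_of_ord j) => i' j'; clear; lia.
transitivity (\prod_(i < n.+2) \prod_(j < n.*2.+2) bit_weight b i j).
  by rewrite pair_big.
rewrite -(big_mkord xpredT (fun i => \prod_(j < n.*2.+2) bit_weight b i j)).
have -> : index_iota 0 n.+2 = 0%N :: iota 1 n ++ [:: n.+1].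
  by rewrite /index_iota subn0 -[[:: _]]/(iota (1 + n) 1) -iotaD addn1.
rewrite big_cons big_cat big_seq1 /=.
rewrite big1 ?mul1r; last by move=> j _; apply: w1.
rewrite [X in _ * X]big1 ?mulr1; last by move=> j _; apply: w1; clear; lia.
apply: eq_big_seq => i; rewrite mem_iota => ni.
rewrite -(big_mkord xpredT (bit_weight b i)) /index_iota subn0.
(* There are [i] columns before the left boundary vertex of row [i], then those up to its right
   boundary vertex, and [i.-1] after it. *)
rewrite [in iota 0 _](_ : n.*2.+2 = (i + (n.*2.+3 - i.*2) + i.-1)%N); last first.
  by move: ni; clear; lia.
rewrite !iotaD !big_cat /= add0n.
rewrite big_seq big1 ?mul1r; last first.
  by move=> j; rewrite mem_iota => ij; apply: w1; move: ij; clear; lia.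
rewrite [X in _ * X]big_seq [X in _ * X]big1 ?mulr1 // => j.
by rewrite mem_iota => ij; apply: w1; move: ni ij; clear; lia.
Qed.

Lemma Z_AST_edge_sum :
  Z_AST q p u v = edge_sum (edges_from n 1) all_bits_weight (bits (top_arcs n)).
Proof.
have ext b b' : b =1 b' -> all_bits_weight b = all_bits_weight b'.
  move=> bb'; do 2!apply: eq_bigr => ? _.
  by rewrite /bit_weight !bb'.
have inner e : e \in edges_from n 1 -> is_edge e /\ e.1 != (true, 1%N).
  rewrite mem_edges_from // => /andP[-> e1]; split=> //.
  by apply: contraTneq e1 => ->.
rewrite -arc_sum_edges ?uniq_edges_from //; first last.
- move=> e /inner[ee e1]; apply/negP => /top_arcsP[e' [e'1 ee'] /arc_inj eE].
  by move: e1; rewrite eE // e'1 eqxx.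
- by apply/allP => e /inner[].
rewrite Z_AST_orients -sum_orients; first last.
- move=> a; rewrite mem_cat => /orP[/mapP[e /inner[ee e1] ->]|].
    apply/negP => /top_arcsP[e' [e'1 ee'] /arc_inj eE].
    by move: e1; rewrite eE // e'1 eqxx.
  case/mapP=> _ /mapP[e /inner[ee _] ->] ->.
  by apply/negP => /top_arcsP[e' [_ ee'] /esym]; apply: arc_flip.
- rewrite cat_uniq (map_inj_uniq (inv_inj (@flipK (grid n)))).
  rewrite map_inj_in_uniq ?uniq_edges_from ?andbT //=; last first.
    by move=> e e' /inner[ee _] /inner[ee' _]; apply: arc_inj.
  apply/hasPn => _ /mapP[_ /mapP[e /inner[ee _] ->] ->].
  by apply/mapP => -[e' /inner[ee' _] /esym]; apply: arc_flip.
apply: eq_bigr => O; rewrite orients_edges => /andP[ori _].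
rewrite -prod_bit_weight; apply: eq_bigr => x _.
by rewrite -vertex_weight_bits.
Qed.

End Weights.

(** * From the sum over bits to the row-by-row sum *)

Section TransferSum.

Variables (n : nat) (F : fieldType) (q p : F) (u : 'I_n -> F).
Local Notation bit_weight := (bit_weight q p u p).
Local Notation edges_from := (edges_from n).
Local Notation half_row := (half_row q p).
Local Notation triangle_sum := (triangle_sum q p).
Local Notation param := (param u p).

Definition params k : seq F := [seq param i | i <- iota k (n.+1 - k)].

Definition weight_from k (b : edge -> bool) : F :=
  \prod_(i <- iota k (n.+1 - k))
    \prod_(j <- iota i (n.*2.+3 - i.*2)) bit_weight b i j.

Lemma edge_sum_factor s (a g : (edge -> bool) -> F) b :
  (forall e b v, e \in s -> a (set_bit b e v) = a b) ->
  edge_sum s (fun b => a b * g b) b = a b * edge_sum s g b.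
Proof.
elim: s b => //= e s IH b sa; rewrite mulr_sumr; apply: eq_bigr => v _.
rewrite IH ?sa ?mem_head // => e' b' v' e's.
by rewrite sa // inE e's orbT.
Qed.

Lemma eq_edge_sum_fun s (g h : (edge -> bool) -> F) b :
  g =1 h -> edge_sum s g b = edge_sum s h b.
Proof.
by move=> gh; elim: s b => //= e s IH b; apply: eq_bigr => v _; apply: IH.
Qed.

Lemma bit_weight_set e b v i j :
  e \notin [:: (true, i, j); (true, i.+1, j); (false, i, j.-1); (false, i, j)] ->
  bit_weight (set_bit b e v) i j = bit_weight b i j.
Proof.
rewrite !inE !negb_or ![e == _]eq_sym => /and4P[e1 e2 e3 e4].
by rewrite /bit_weight /set_bit (negPf e1) (negPf e2) (negPf e3) (negPf e4).
Qed.

Lemma bit_weight_left b k : (0 < k <= n)%N ->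
  bit_weight b k k = left_wt q p (param k) (b (true, k, k)) (b (false, k, k)).
Proof.
move=> kn; rewrite /bit_weight ifF; first by rewrite ifT //=; lia.
by apply/negbTE => /=; lia.
Qed.

Lemma bit_weight_right b k j : (0 < k <= n)%N -> j = (n.*2.+2 - k)%N ->
  bit_weight b k j = right_wt q p (param k) (b (true, k, j)) (b (false, k, j.-1)).
Proof.
move=> kn jE; rewrite /bit_weight ifF; last by apply/negbTE => /=; lia.
by rewrite ifF ?ifT //=; [lia|apply/negbTE => /=; lia].
Qed.

Lemma bit_weight_bulk b k j : (0 < k <= n)%N -> (k < j < n.*2.+2 - k)%N ->
  bit_weight b k j = bulk_wt q (param k * param (minn j (2 * n + 2 - j)))
    (b (true, k, j)) (b (true, k.+1, j)) (b (false, k, j.-1)) (b (false, k, j)).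
Proof. by move=> kn kj; rewrite /bit_weight ifT //=; lia. Qed.

Lemma params_pal k : (0 < k <= n)%N ->
  [seq param (minn j (2 * n + 2 - j)) | j <- iota k.+1 (n.*2.+1 - k.*2)]
  = pal p (params k.+1).
Proof.
move=> kn; have -> : (n.*2.+1 - k.*2 = (n - k) + (1 + (n - k)))%N by lia.
rewrite !iotaD !map_cat /= /pal /params subSS; congr (_ ++ _ :: _).
- by apply/eq_in_map => j; rewrite mem_iota => jk; rewrite (minn_idPl _) //; lia.
(* The middle column has index n + 1, where [param] takes its default value, here [p]. *)
- rewrite /param insubN //; rewrite minnE; lia.
rewrite -map_rev; apply: (@eq_from_nth _ 0); first by rewrite !size_map size_rev !size_iota.
move=> j; rewrite size_map size_iota => jk.
rewrite !(nth_map 0%N) ?size_rev ?size_iota // nth_rev ?size_iota //.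
by rewrite !nth_iota //; [congr param; rewrite minnE; lia|lia].
Qed.

(** The columns before [j] have been summed already: the bits below them are fixed in [b] and are
    put in front of those still to come. The last hypothesis is the induction hypothesis of
    [edge_sum_triangle_sum] for the rows below. *)
Lemma edge_sum_cols k j m b : (0 < k <= n)%N -> (k < j)%N ->
  (j + m = n.*2.+2 - k)%N ->
  (forall b, edge_sum (edges_from k.+1) (weight_from k.+1) b
   = triangle_sum (params k.+1) [seq b (true, k.+1, i) | i <- iota k.+1 (n.*2.+1 - k.*2)]) ->
  edge_sum (col_edges k (iota j m) ++ edges_from k.+1)
    (fun b => (\prod_(i <- iota j m) bit_weight b k i)
              * (bit_weight b k (n.*2.+2 - k) * weight_from k.+1 b)) b
  = half_row (param k) (b (false, k, j.-1))
      [seq param (minn i (2 * n + 2 - i)) | i <- iota j m]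
      (fun bs => triangle_sum (params k.+1)
         ([seq b (true, k.+1, i) | i <- iota k.+1 (j - k.+1)] ++ bs))
      [seq b (true, k, i) | i <- iota j m.+1].
Proof.
move=> kn + + IH; elim: m j b => [|m IHm] j b kj jm.
  have jE : j = (n.*2.+2 - k)%N by lia.
  under eq_edge_sum_fun => b' do rewrite big_nil mul1r.
  rewrite edge_sum_factor; last first.
    move=> e b' v; rewrite mem_edges_from // => /andP[_ ke]; apply: bit_weight_set.
    by rewrite !inE; apply/negP => /or4P[] /eqP eE; move: ke; rewrite eE /=; lia.
  rewrite IH /= cats0 bit_weight_right ?jE //; congr (_ * triangle_sum _ _).
  by congr map; congr iota; lia.
rewrite /=.
transitivity (\sum_(h : bool) \sum_(v : bool)
   edge_sum (col_edges k (iota j.+1 m) ++ edges_from k.+1)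
   (fun b => bit_weight b k j * ((\prod_(i <- iota j.+1 m) bit_weight b k i)
              * (bit_weight b k (n.*2.+2 - k) * weight_from k.+1 b)))
   (set_bit (set_bit b (false, k, j) h) (true, k.+1, j) v)).
  do 2![apply: eq_bigr => ? _]; apply: eq_edge_sum_fun => b'.
  by rewrite big_cons -!mulrA.
apply: eq_bigr => h _; apply: eq_bigr => v _.
rewrite edge_sum_factor; last first.
  move=> e b' v'; rewrite mem_cat mem_col_edges mem_iota mem_edges_from //.
  move=> eE; apply: bit_weight_set; rewrite !inE.
  by apply/negP => /or4P[] /eqP e1; move: eE kj; rewrite e1 /=; clear; lia.
have jj : (j.-1 == j) = false by apply/negbTE; move: kj; clear; lia.
rewrite IHm; [|lia|lia].
rewrite bit_weight_bulk //; last lia.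
set b' := set_bit _ _ _.
have b1 i : b' (true, k, i) = b (true, k, i).
  by rewrite /b' /set_bit !xpair_eqE /= (ltn_eqF (leqnn k.+1)).
have b2 : b' (true, k.+1, j) = v by rewrite /b' /set_bit eqxx.
have b3 : b' (false, k, j.-1) = b (false, k, j.-1).
  by rewrite /b' /set_bit !xpair_eqE /= jj andbF.
have b4 : b' (false, k, j) = h by rewrite /b' /set_bit !xpair_eqE /= !eqxx.
rewrite b1 b2 b3 b4 (eq_map b1); congr (_ * _); apply: eq_half_row => bs.
have -> : (j.+1 - k.+1 = (j - k.+1) + 1)%N by lia.
rewrite iotaD map_cat -catA /=; have -> : (k.+1 + (j - k.+1) = j)%N by lia.
rewrite b2; congr (triangle_sum _ (_ ++ _)); apply/eq_in_map => i; rewrite mem_iota => ij.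
rewrite /b' /set_bit !xpair_eqE /= [i == j](_ : _ = false) ?andbF //.
by apply/negbTE; move: ij; clear; lia.
Qed.

Lemma edge_sum_triangle_sum k b : (0 < k)%N ->
  edge_sum (edges_from k) (weight_from k) b
  = triangle_sum (params k) [seq b (true, k, i) | i <- iota k (n.*2.+3 - k.*2)].
Proof.
have [m] := ubnP (n.+1 - k); elim: m k b => // m IH k b km k0.
have [kn|kn] := leqP k n; last first.
  have k_n : (n.+1 - k = 0)%N by lia.
  by rewrite /edges_from /weight_from /params k_n /= big_nil.
have k0n : (0 < k <= n)%N by rewrite k0.
have paramsE : params k = param k :: params k.+1 by rewrite /params subSn.
have iotaE : iota k (n.*2.+3 - k.*2)
    = k :: iota k.+1 (n.*2.+1 - k.*2) ++ [:: (n.*2.+2 - k)%N].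
  have -> : (n.*2.+3 - k.*2 = 1 + ((n.*2.+1 - k.*2) + 1))%N by lia.
  rewrite !iotaD /= addn1; congr (_ :: _ ++ [:: _]); lia.
rewrite edges_fromS // paramsE [LHS]/=.
have rowE b' : weight_from k b' = bit_weight b' k k *
    ((\prod_(i <- iota k.+1 (n.*2.+1 - k.*2)) bit_weight b' k i)
     * (bit_weight b' k (n.*2.+2 - k) * weight_from k.+1 b')).
  rewrite /weight_from subSn // big_cons iotaE big_cons big_cat big_seq1 /=.
  by rewrite subSS -!mulrA.
rewrite iotaE /= -/(pal p (params k.+1)) -params_pal //.
apply: eq_bigr => h _.
rewrite (eq_edge_sum_fun _ _ rowE) edge_sum_factor; last first.
  move=> e b' v'; rewrite mem_cat mem_col_edges mem_iota mem_edges_from //.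
  move=> eE; apply: bit_weight_set; rewrite !inE.
  by apply/negP => /or4P[] /eqP e1; move: eE k0; rewrite e1 /=; clear; lia.
rewrite edge_sum_cols //; [|lia|move=> b']; last first.
  rewrite IH //; last lia.
rewrite bit_weight_left //; set b' := set_bit _ _ _.
have b1 i : b' (true, k, i) = b (true, k, i) by [].
rewrite b1 /= {1 2}/b' /set_bit eqxx subnn /= (eq_map b1).
congr (_ * half_row _ _ _ _ _).
transitivity [seq b (true, k, i) | i <- iota k.+1 (n.*2.+1 - k.*2).+1] => //.
by rewrite -[(_ - _).+1]addn1 iotaD; congr (map _ (_ ++ [:: _])); lia.
Qed.

Lemma Z_AST_top_up_sum : Z_AST q p u p = top_up_sum q p [seq u i | i <- enum 'I_n].
Proof.
have params1 : params 1 = [seq u i | i <- enum 'I_n].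
  rewrite /params subSS subn0; apply: (@eq_from_nth _ 0).
    by rewrite size_map size_iota size_map size_enum_ord.
  move=> i; rewrite size_map size_iota => ni.
  rewrite (nth_map 0%N) ?size_iota // (nth_map (Ordinal ni)) ?size_enum_ord //.
  rewrite nth_iota // /param add1n /= insubT; congr u.
  by apply/val_inj; rewrite /= nth_enum_ord.
rewrite Z_AST_edge_sum.
have -> : edge_sum (edges_from 1) (all_bits_weight q p u p) (bits (top_arcs n))
    = edge_sum (edges_from 1) (weight_from 1) (bits (top_arcs n)).
  by apply: eq_edge_sum_fun => b; rewrite /all_bits_weight /weight_from subSS subn0.
rewrite edge_sum_triangle_sum // params1 /top_up_sum; congr triangle_sum; apply: (@eq_from_nth _ true).
  by rewrite size_nseq size_map size_iota size_map size_enum_ord; lia.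
move=> i; rewrite size_map size_iota => ni.
rewrite (nth_map 0%N) ?size_iota // nth_iota // nth_nseq.
have ee : is_edge n (true, 1%N, (1 + i)%N) by move: ni => /=; clear; lia.
by rewrite /bits ee mem_top_arcs //; case: ifP.
Qed.

End TransferSum.

(** * Specialization to indeterminates *)

Section Indeterminates.

Variables (R : realType) (n : nat).

Lemma expi_pi6_4 : expi_pi6 R ^+ 4 = expi_pi6 R ^+ 2 - 1.
Proof.
rewrite /expi_pi6; set x := pi / 6 : R.
have x_pihalf : x *+ 2 + x = pi / 2 by rewrite /x; field.
have c0 : cos x != 0.
  apply: lt0r_neq0; apply: cos_gt0_pihalf; have := pi_gt0 R.
  by rewrite /x => pi0; apply/andP; split; lra.
have c2 : cos x ^+ 2 = 3 / 4.
  (* This is cos (3 x) = 0, since 3 x = pi / 2. Only the squares of cos x and sin x are needed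
     afterwards. *)
  have : cos x * (4 * cos x ^+ 2 - 3) = 0.
    rewrite -[RHS](cos_pihalf R) -x_pihalf cosD cos_mulr2n sin_mulr2n.
    have s2 := sin2cos2 x; ring: s2.
  by move/eqP; rewrite mulf_eq0 (negPf c0) /= => /eqP c4; lra.
have s2 : sin x ^+ 2 = 1 / 4 by rewrite sin2cos2 c2; field.
move: (cos x) (sin x) c2 s2 => c s c2 s2.
apply/eqP; rewrite eq_complex /=; apply/andP; split; apply/eqP.
  transitivity (c ^+ 2 * c ^+ 2 - 6 * (c ^+ 2 * s ^+ 2) + s ^+ 2 * s ^+ 2).
    by ring.
  transitivity (c ^+ 2 - s ^+ 2 - 1); last by ring.
  by rewrite c2 s2; field.
transitivity (4 * (c * s) * (c ^+ 2 - s ^+ 2)); first by ring.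
by rewrite c2 s2; field.
Qed.

Definition indet (k : 'I_n.+1) : ratfun R n := tofrac ('X_k : {mpoly (R[i])[n.+1]}).

Lemma ratfun_natr_neq0 m : (0 < m)%N -> m%:R != 0 :> ratfun R n.
Proof.
move=> m0; rewrite -(rmorph_nat (@tofrac {mpoly (R[i])[n.+1]})) tofrac_eq0.
by rewrite -mpolyC_nat mpolyC_eq0 pnatr_eq0 -lt0n.
Qed.

(** Evaluation at X_i = i + 2 sends the indeterminates to distinct integers greater than 1, whose
    powers are again distinct; the next lemmas use the same evaluation to avoid 0 and 1. *)
Lemma indet_exp_inj k l m : (0 < m)%N -> indet k ^+ m = indet l ^+ m -> k = l.
Proof.
move=> m0; rewrite /indet -!rmorphXn => /eqP; rewrite tofrac_eq => /eqP.
move/(congr1 (meval (fun i => i.+2%:R))); rewrite !rmorphXn /= !mevalXU.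
by rewrite -!natrX => /eqP; rewrite eqr_nat eqn_exp2r // => /eqP[/val_inj].
Qed.

Lemma indet_exp_neq1 k m : (0 < m)%N -> indet k ^+ m != 1.
Proof.
move=> m0; rewrite /indet -rmorphXn -(rmorph1 (@tofrac {mpoly (R[i])[n.+1]})).
rewrite tofrac_eq; apply/eqP => /(congr1 (meval (fun i => i.+2%:R))).
rewrite rmorphXn rmorph1 /= mevalXU -natrX => /eqP.
by rewrite pnatr_eq1 -[1%N](exp1n m) eqn_exp2r.
Qed.

Lemma indet_exp_mul_neq1 k l m : (0 < m)%N -> indet k ^+ m * indet l ^+ m != 1.
Proof.
move=> m0; rewrite /indet -exprMn -rmorphM -rmorphXn.
rewrite -(rmorph1 (@tofrac {mpoly (R[i])[n.+1]})).
rewrite tofrac_eq; apply/eqP => /(congr1 (meval (fun i => i.+2%:R))).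
rewrite rmorphXn rmorphM rmorph1 /= !mevalXU -natrM -natrX => /eqP.
by rewrite pnatr_eq1 -[1%N](exp1n m) eqn_exp2r.
Qed.

Lemma indet_neq0 k : indet k != 0.
Proof.
rewrite tofrac_eq0; apply/eqP => /(congr1 (meval (fun i => i.+2%:R))).
by rewrite rmorph0 mevalXU => /eqP; rewrite pnatr_eq0.
Qed.

Lemma generic_indet :
  generic (indet_p R n) [seq indet_u R i | i <- enum 'I_n].
Proof.
set us := [seq _ | i <- _].
have us12 x : x \in us -> exists2 k, k != ord_max & x = indet k.
  case/mapP=> i _ ->; exists (widen_ord (leqnSn n) i) => //.
  by rewrite -val_eqE /= ltn_eqF.
have mul1 x y : x \in us -> y \in us -> x ^+ 12 * y ^+ 12 != 1.
  by move=> /us12[k _ ->] /us12[l _ ->]; apply: indet_exp_mul_neq1.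
have inj12 : {in us &, injective (fun x => x ^+ 12)}.
  by move=> _ _ /us12[k _ ->] /us12[l _ ->] /indet_exp_inj -> .
have uus : uniq us.
  rewrite map_inj_uniq ?enum_uniq // => i j /(congr1 (fun x => x ^+ 1)).
  by move/indet_exp_inj => /(_ isT) /(congr1 val) /= /val_inj.
have inv_ne (x y : ratfun R n) : x * y != 1 -> y != 0 -> x != y^-1.
  by move=> xy y0; apply: contraNneq xy => ->; rewrite mulVf.
rewrite /generic /= inE !negb_or !mem_cat !negb_or cat_uniq.
have uus12 : uniq [seq x ^+ 12 | x <- us] by rewrite map_inj_in_uniq.
have uusV : uniq [seq (x ^+ 12)^-1 | x <- us].
  by rewrite map_inj_in_uniq // => x y xus yus /invr_inj; apply: inj12.
rewrite -/(indet _) (indet_exp_neq1 ord_max) // uus12 uusV andbT -!andbA /=.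
apply/and5P; split.
- apply/mapP => -[_ /us12[k kmax ->] /indet_exp_inj e].
  by move: kmax; rewrite -e ?eqxx.
- apply/mapP => -[_ /us12[k _ ->] /eqP]; apply/negP/inv_ne.
    exact: indet_exp_mul_neq1.
  exact/expf_neq0/indet_neq0.
- apply/mapP => -[_ /us12[k _ ->] /esym/eqP]; apply/negP.
  exact: indet_exp_neq1.
- apply/mapP => -[_ /us12[k _ ->] /eqP]; apply/negP/inv_ne.
    by rewrite mul1r indet_exp_neq1.
  exact/expf_neq0/indet_neq0.
- apply/hasPn => _ /mapP[y yus ->]; apply/mapP => -[x xus /esym/eqP].
  apply/negP/inv_ne; first exact: mul1.
  by have [k _ ->] := us12 y yus; apply/expf_neq0/indet_neq0.
Qed.

End Indeterminates.

Theorem theorem5p3 (R : realType) (n : nat) (n_gt0 : (0 < n)%N) :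
  let q : ratfun R n := q_pi6 R n in
  let p : ratfun R n := indet_p R n in
  let u : 'I_n -> ratfun R n := @indet_u R n in
  Z_AST q p u p =
    3%:R ^- 'C(n.+1, 2)
    * (\prod_(i < n) (p ^+ 2 * u i ^+ 2 + 1 + p^-1 ^+ 2 * (u i)^-1 ^+ 2))
    * schur (double_staircase n) (squares_and_inverses u).
Proof.
move=> q p u.
have q4 : q ^+ 4 = q ^+ 2 - 1.
  rewrite /q /q_pi6 -!rmorphXn expi_pi6_4 rmorphB rmorph1.
  by rewrite rmorphB rmorph1.
rewrite Z_AST_top_up_sum top_up_sum_schur_form ?ratfun_natr_neq0 //; first last.
- exact: generic_indet.
- exact: indet_neq0.
rewrite /schur_form size_map size_enum_ord big_map big_enum.
congr (_ * _).
have -> : squares_and_inverses u = with_inverses (sqr_seq [seq u i | i <- enum 'I_n]).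
  rewrite /squares_and_inverses /with_inverses /sqr_seq -!map_comp.
  by congr flatten; apply: eq_map => i /=; rewrite exprVn.
by rewrite schur_double_staircase // size_with_inverses size_map size_map size_enum_ord.
Qed.
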